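(* Let $$\mathcal{S}^x_{[t_0,T]}=\Bigl\{x(\cdot)\in H^1(t_0,T;\mathbb{R}^n)\ \Big|\ \exists\, u(\cdot)\in L^2(t_0,T;\mathbb{R}^d),\ \xi\in\mathbb{R}^n\ \text{s.t.}\ \tfrac{d}{d\tau}x(\tau)=F(\tau)x(\tau)+G(\tau)Q^{1/2}(\tau)u(\tau),\ x(t_0)=\Pi_0^{1/2}\xi\Bigr\},$$ equipped with the scalar product $$\langle x^1,x^2\rangle_{\mathcal{S}^x_{[t_0,T]}}=\langle\xi^1,\xi^2\rangle+\langle\Sigma_Tx^1(T),x^2(T)\rangle+\int_{t_0}^T\langle u^1(s),u^2(s)\rangle ds+\int_{t_0}^T\langle H^*(s)R^{-1}(s)H(s)x^1(s),x^2(s)\rangle ds,$$ where $(\xi^1,u^1(\cdot))$ and $(\xi^2,u^2(\cdot))$ are the representatives of $x^1(\cdot)$ and $x^2(\cdot)$ respectively. Then $(\mathcal{S}^x_{[t_0,T]},\langle\cdot,\cdot\rangle_{\mathcal{S}^x_{[t_0,T]}})$ is a (vector-valued) reproducing kernel Hilbert space, and its reproducing kernel is $$K(s,t|T)=\Phi_{F,\Sigma}(s,t_0)\Pi_0^{1/2}\bigl(\mathrm{Id}+\Pi_0^{1/2}\Sigma(t_0)\Pi_0^{1/2}\bigr)^{-1}\Pi_0^{1/2}\Phi_{F,\Sigma}^*(t,t_0)+\int_{t_0}^{\min(s,t)}\Phi_{F,\Sigma}(s,\tau)G(\tau)Q(\tau)G^*(\tau)\Phi_{F,\Sigma}^*(t,\tau)\,d\tau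 .$$
   Context: Fix $t_0<T$ and positive integers $n,m,d$. $\mathbb{R}^{n,*}$ is the dual of $\mathbb{R}^n$, $*$ denotes transposition, $\mathrm{Id}$ the identity, and $H^1(t_0,T;\mathbb{R}^n)$ is the usual Sobolev space. Coefficients: $F\in L^1([t_0,T];\mathbb{R}^{n\times n})$, $G\in L^2([t_0,T];\mathbb{R}^{n\times d})$, $H\in L^2([t_0,T];\mathbb{R}^{m\times n})$, $Q\in L^1([t_0,T];\mathbb{R}^{d\times d})$ symmetric positive semidefinite, $R\in L^2([t_0,T];\mathbb{R}^{m\times m})$ symmetric with $R(\cdot)\succcurlyeq r\,\mathrm{Id}$ a.e. for some $r>0$. $\Pi_0,\Sigma_T\in\mathbb{R}^{n\times n}$ are symmetric positive semidefinite. Neither $Q$, $\Pi_0$ nor $\Sigma_T$ is assumed invertible. Square roots are the positive semidefinite ones. $\Sigma(\cdot)$ is the symmetric positive semidefinite solution on $[t_0,T]$ (it exists on the whole interval) of the backward Riccati equation $$-\tfrac{d}{dt}\Sigma=\Sigma F+F^*\Sigma-\Sigma GQG^*\Sigma+H^*R^{-1}H,\quad\Sigma(T)=\Sigma_T,$$ and $\Phi_{F,\Sigma}$ is the semigroup (transition matrix) given by $\partial_\tau\Phi_{F,\Sigma}(\tau,t)=(F(\tau)-G(\tau)Q(\tau)G^*(\tau)\Sigma(\tau))\Phi_{F,\Sigma}(\tau,t)$, $\Phi_{F,\Sigma}(t,t)=\mathrm{Id}$; $\Phi^*_{F,\Sigma}(\tau,t)$ is the transpose of $\Phi_{F,\Sigma}(\tau,t)$.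 Representative: for $x\in\mathcal{S}^x_{[t_0,T]}$, among all pairs $(u(\cdot),\xi)$ satisfying the relations in the definition of $\mathcal{S}^x_{[t_0,T]}$ for this $x$, the representative of $x$ is the (unique) pair minimizing $\int_{t_0}^T\|u(t)\|^2dt+\|\xi\|^2$. A Hilbert space $\mathcal{H}$ of functions $f:[t_0,T]\to\mathbb{R}^n$ is a (vector-valued) reproducing kernel Hilbert space with reproducing kernel $K:[t_0,T]^2\to\mathcal{L}(\mathbb{R}^{n,*},\mathbb{R}^n)$ if for all $t\in[t_0,T]$ and $z\in\mathbb{R}^{n,*}$: $K(\cdot,t)z\in\mathcal{H}$, and $\langle z,f(t)\rangle=\langle f,K(\cdot,t)z\rangle_{\mathcal{H}}$ for all $f\in\mathcal{H}$.
   Formalization: Assumes GQG* is in L^1 (otherwise K(T,T|T) diverges). Proved for absolutely continuous (W^{1,1}) trajectories; for the H^1 space, assumes that all trajectories lie in H^1, since for F in L^1 only, the literal H^1 space may not contain K(.,t)z. *)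

(* Defs.v *)
From HB Require Import structures.
From mathcomp Require Import all_boot all_order all_algebra.
From mathcomp Require Import all_classical all_reals all_analysis.

Set Implicit Arguments.
Unset Strict Implicit.
Unset Printing Implicit Defensive.

Import Order.TTheory GRing.Theory Num.Theory.
Import numFieldNormedType.Exports.

Local Open Scope classical_set_scope.
Local Open Scope ring_scope.

Section Matrices.
Context {R : realType}.

(* The norm that MathComp-Analysis puts on matrices is the sup norm, so every
   Euclidean quantity below goes through [dotp]. *)
Definition dotp {n : nat} (x y : 'cV[R]_n) : R := \sum_i x i 0 * y i 0.

Definition is_psd {n : nat} (A : 'M[R]_n) : Prop :=
  A^T = A /\ forall v : 'cV[R]_n, 0 <= dotp (A *m v) v.

(* The unique positive semidefinite square root when [A] is itself positive
   semidefinite; the default value 0 is taken only when [A] is not. *)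
Definition psd_sqrt {n : nat} (A : 'M[R]_n) : 'M[R]_n :=
  xget 0 [set S | is_psd S /\ S *m S = A].

End Matrices.

Section RKHS.
Context {R : realType} {U : Type} {n : nat}.
Implicit Types (D : set U) (E : set (U -> 'cV[R]_n)).
Implicit Types (ip : (U -> 'cV[R]_n) -> (U -> 'cV[R]_n) -> R).

(* Functions [D -> 'cV_n] are represented by functions on the ambient type [U],
   two of them being identified when they agree on [D].  Accordingly [E] must be
   saturated for agreement on [D] and [ip f f = 0] must characterize f = 0 on [D];
   with Cauchy-Schwarz this makes [ip] compatible with that identification. *)
Record is_hilbert_function_space D E ip : Prop := {
  hfs_zero : E (fun=> 0);
  hfs_lin : forall (a : R) f g, E f -> E g -> E (fun t => a *: f t + g t);
  hfs_ext : forall f g, E f -> (forall t, D t -> f t = g t) -> E g;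
  hfs_sym : forall f g, E f -> E g -> ip f g = ip g f;
  hfs_ip_lin : forall (a : R) f g h, E f -> E g -> E h ->
    ip (fun t => a *: f t + g t) h = a * ip f h + ip g h;
  hfs_ge0 : forall f, E f -> 0 <= ip f f;
  hfs_def : forall f, E f -> (ip f f = 0 <-> forall t, D t -> f t = 0);
  hfs_complete : forall f_ : nat -> (U -> 'cV[R]_n),
    (forall k, E (f_ k)) ->
    (forall e : R, 0 < e -> exists N, forall i j, (N <= i)%N -> (N <= j)%N ->
      Num.sqrt (ip (fun t => f_ i t - f_ j t) (fun t => f_ i t - f_ j t)) < e) ->
    exists2 f, E f &
      Num.sqrt (ip (fun t => f_ k t - f t) (fun t => f_ k t - f t))
        @[k --> \oo] --> (0 : R)
}.

(* The dual of 'cV_n is 'rV_n, with pairing <z, x> = z *m x, and the matrix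
   [K s t] stands for the linear map 'rV_n -> 'cV_n sending z to K s t *m z^T. *)
Definition is_rkhs D E ip (K : U -> U -> 'M[R]_n) : Prop :=
  [/\ is_hilbert_function_space D E ip,
      forall t (z : 'rV[R]_n), D t -> E (fun s => K s t *m z^T) &
      forall t (z : 'rV[R]_n) f, D t -> E f ->
        (z *m f t) 0 0 = ip f (fun s => K s t *m z^T)].

End RKHS.

Section FunctionSpaces.
Context {R : realType}.
Notation mu := (@lebesgue_measure R).

(* A is in L^p(a, b; R^(m x n)). *)
Definition Lmx {m n : nat} (p : \bar R) (a b : R) (A : R -> 'M[R]_(m, n)) : Prop :=
  forall i j, ((fun t => A t i j) \_ `[a, b] : R -> R) \in Lfun mu p.

Definition mxint {m n : nat} (a b : R) (A : R -> 'M[R]_(m, n)) : 'M[R]_(m, n) :=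
  \matrix_(i, j) \int[mu]_(t in `[a, b]) A t i j.

(* X is absolutely continuous on [a, b] with almost everywhere derivative V. *)
Definition ac_deriv {m n : nat} (a b : R) (X V : R -> 'M[R]_(m, n)) : Prop :=
  Lmx 1 a b V /\ forall t, t \in `[a, b] -> X t = X a + mxint a t V.

(* X is (the continuous representative of) an element of W^{1,p}(a, b). *)
Definition sobolev1 {m n : nat} (p : \bar R) (a b : R) (X : R -> 'M[R]_(m, n)) : Prop :=
  exists2 V : R -> 'M[R]_(m, n), Lmx p a b V & ac_deriv a b X V.

Definition W11 {n : nat} (a b : R) : set (R -> 'cV[R]_n) := sobolev1 1 a b.

Definition H1 {n : nat} (a b : R) : set (R -> 'cV[R]_n) := sobolev1 2%:E a b.

End FunctionSpaces.

(* W is the observation weight usually written R, a letter taken here by the reals. *)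
Section LinearQuadratic.
Context {R : realType} {n m d : nat}.
Notation mu := (@lebesgue_measure R).
Implicit Types (F : R -> 'M[R]_n) (G : R -> 'M[R]_(n, d)).
Implicit Types (H : R -> 'M[R]_(m, n)) (Q : R -> 'M[R]_d) (W : R -> 'M[R]_m).
Implicit Types (SigmaT : 'M[R]_n) (Sigma : R -> 'M[R]_n).
Implicit Types (Phi : R -> R -> 'M[R]_n).
Implicit Types (x : R -> 'cV[R]_n) (u : R -> 'cV[R]_d) (xi : 'cV[R]_n).

Definition is_riccati_solution (t0 T : R) F G H Q W SigmaT Sigma : Prop :=
  [/\ forall t, t \in `[t0, T] -> is_psd (Sigma t),
      ac_deriv t0 T Sigma (fun t =>
        - (Sigma t *m F t + (F t)^T *m Sigma t
           - Sigma t *m G t *m Q t *m (G t)^T *m Sigma t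
           + (H t)^T *m invmx (W t) *m H t)) &
      Sigma T = SigmaT].

Definition is_transition_matrix (t0 T : R) F G Q Sigma Phi : Prop :=
  forall t, t \in `[t0, T] ->
    ac_deriv t0 T (Phi^~ t) (fun tau =>
      (F tau - G tau *m Q tau *m (G tau)^T *m Sigma tau) *m Phi tau t) /\
    Phi t t = 1%:M.

Definition generates (t0 T : R) F G Q (Pi0 : 'M[R]_n) x u xi : Prop :=
  [/\ Lmx 2%:E t0 T u,
      ac_deriv t0 T x (fun t => F t *m x t + G t *m psd_sqrt (Q t) *m u t) &
      x t0 = psd_sqrt Pi0 *m xi].

Definition trajectories (X : set (R -> 'cV[R]_n)) (t0 T : R) F G Q Pi0 :
    set (R -> 'cV[R]_n) :=
  [set x | X x /\ exists u xi, generates t0 T F G Q Pi0 x u xi].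

Definition energy (t0 T : R) u xi : R :=
  (\int[mu]_(t in `[t0, T]) dotp (u t) (u t)) + dotp xi xi.

Definition is_representative (t0 T : R) F G Q (Pi0 : 'M[R]_n) x u xi : Prop :=
  generates t0 T F G Q Pi0 x u xi /\
  forall u' xi', generates t0 T F G Q Pi0 x u' xi' ->
    energy t0 T u xi <= energy t0 T u' xi'.

(* u is determined up to a null set only, which [trajectory_ip] does not see. *)
Definition representative (t0 T : R) F G Q Pi0 x : (R -> 'cV[R]_d) * 'cV[R]_n :=
  xget (fun=> 0, 0) [set p | is_representative t0 T F G Q Pi0 x p.1 p.2].

Definition trajectory_ip (t0 T : R) F G H Q W Pi0 SigmaT (x1 x2 : R -> 'cV[R]_n) : R :=
  let: (u1, xi1) := representative t0 T F G Q Pi0 x1 in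
  let: (u2, xi2) := representative t0 T F G Q Pi0 x2 in
  dotp xi1 xi2 + dotp (SigmaT *m x1 T) (x2 T)
  + (\int[mu]_(s in `[t0, T]) dotp (u1 s) (u2 s))
  + (\int[mu]_(s in `[t0, T])
       dotp ((H s)^T *m invmx (W s) *m H s *m x1 s) (x2 s)).

Definition trajectory_kernel (t0 : R) G Q Pi0 Sigma Phi (s t : R) : 'M[R]_n :=
  let P := psd_sqrt Pi0 in
  Phi s t0 *m P *m invmx (1%:M + P *m Sigma t0 *m P) *m P *m (Phi t t0)^T
  + mxint t0 (Num.min s t) (fun tau =>
      Phi s tau *m G tau *m Q tau *m (G tau)^T *m (Phi t tau)^T).

End LinearQuadratic.

(* Main.v *)
Require Import Defs.
From HB Require Import structures.
From mathcomp Require Import all_boot all_order all_algebra.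
From mathcomp Require Import all_classical all_reals all_analysis.
From mathcomp Require Import measurable_realfun ring lra.

Set Implicit Arguments.
Unset Strict Implicit.
Unset Printing Implicit Defensive.

Import Order.TTheory GRing.Theory Num.Theory.
Import numFieldNormedType.Exports.

Local Open Scope classical_set_scope.
Local Open Scope ring_scope.

(** The theorem is a completion of squares followed by the construction of a
    Hilbert space of functions as a linear image of a Hilbert space.

    Put P = Pi0^(1/2) and B = G Q^(1/2).  To a trajectory x' = F x + B u,
    x(t0) = P xi, attach the feedback control v = u + B^T Sigma x.  By the
    Riccati equation, for two trajectories,
      d/dt <Sigma x1, x2> = <v1, v2> - <u1, u2> - <H^T W^-1 H x1, x2>,
    so that, once integrated ([completion]), the inner product of x1 and x2 is
      <(1 + P Sigma(t0) P) xi1, xi2> + int <v1, v2>,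
    in which neither the state nor the observation occurs any more.  In the
    variables (v, xi) the dynamics is x' = (F - G Q G^T Sigma) x + B v, and
    Duhamel's formula, written with Phi, gives x as a linear image of (v, xi).
    Therefore <z, x(t)> is the inner product of (v, xi) with an explicit element
    of L^2 x R^n ([section_repr]), and the trajectory driven by this element is
    K(., t) z ([section_kernel]).

    The rest is abstract: the functions that are images of a Hilbert space under
    a map all of whose evaluations have Riesz representers, with the norm of the
    smallest preimage, form a reproducing kernel Hilbert space whose kernel is
    the image of the representers ([rkhs_of_feature_map]).  Two pairs (u, xi)
    that generate the same trajectory differ in squared norm exactly as the
    corresponding pairs (v, xi) do ([energy_cost]), hence the representative of
    least energy is the smallest preimage.

    Four facts of analysis carry these steps.  The positive semidefinite square
    root is a pointwise limit of polynomials in the matrix, up to a scalar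
    factor, hence depends measurably on it ([psd_sqrt_meas]);
    products of absolutely continuous functions are absolutely continuous, by
    Fubini ([scalar_acM]); linear equations with integrable coefficients have
    unique solutions, by iterating Gronwall's estimate ([gronwall_zero]); L^2 is
    complete ([L2_complete]).

    Measurability is Borel measurability, so a property that holds almost
    everywhere does not allow functions to be modified freely on the exceptional
    set.  Therefore Q is cut off on a Borel null set outside which it is positive
    semidefinite, and controls are made to vanish there.

    Solutions of the control system are absolutely continuous with integrable
    velocity, which gives the statement in W^(1,1); when they all lie in H^1 the
    two spaces of trajectories are the same set. *)

(** * The Euclidean inner product *)

Section DotProduct.
Context {R : realType}.

Lemma dotpE n (x y : 'cV[R]_n) : dotp x y = (x^T *m y) 0 0.
Proof. by rewrite mxE; apply: eq_bigr => i _; rewrite mxE. Qed.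

Lemma dotpC n (x y : 'cV[R]_n) : dotp x y = dotp y x.
Proof. by apply: eq_bigr => i _; rewrite mulrC. Qed.

Lemma dotpDl n (x y z : 'cV[R]_n) : dotp (x + y) z = dotp x z + dotp y z.
Proof. by rewrite -big_split; apply: eq_bigr => i _; rewrite mxE mulrDl. Qed.

Lemma dotpZl n (a : R) (x z : 'cV[R]_n) : dotp (a *: x) z = a * dotp x z.
Proof. by rewrite mulr_sumr; apply: eq_bigr => i _; rewrite mxE mulrA. Qed.

Lemma dotpDr n (x y z : 'cV[R]_n) : dotp z (x + y) = dotp z x + dotp z y.
Proof. by rewrite !(dotpC z) dotpDl. Qed.

Lemma dotpZr n (a : R) (x z : 'cV[R]_n) : dotp z (a *: x) = a * dotp z x.
Proof. by rewrite !(dotpC z) dotpZl. Qed.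

Lemma dotpNl n (x z : 'cV[R]_n) : dotp (- x) z = - dotp x z.
Proof. by rewrite -scaleN1r dotpZl mulN1r. Qed.

Lemma dotp0l n (z : 'cV[R]_n) : dotp 0 z = 0.
Proof. by rewrite -(scale0r 0) dotpZl mul0r. Qed.

Lemma dotp0r n (z : 'cV[R]_n) : dotp z 0 = 0.
Proof. by rewrite dotpC dotp0l. Qed.

Lemma dotp_ge0 n (x : 'cV[R]_n) : 0 <= dotp x x.
Proof. by apply: sumr_ge0 => i _; rewrite -expr2 sqr_ge0. Qed.

Lemma dotp_eq0 n (x : 'cV[R]_n) : dotp x x = 0 -> x = 0.
Proof.
move=> /eqP; rewrite psumr_eq0 => [/allP x0|i _]; last by rewrite -expr2 sqr_ge0.
apply/matrixP => i j; rewrite !mxE ord1; apply/eqP.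
by have := x0 i (mem_index_enum i); rewrite /= mulf_eq0 orbb.
Qed.

Lemma dotp_mull m n (A : 'M[R]_(m, n)) x y : dotp (A *m x) y = dotp x (A^T *m y).
Proof. by rewrite !dotpE trmx_mul mulmxA. Qed.

Lemma dotp_mulr m n (A : 'M[R]_(m, n)) x y : dotp y (A *m x) = dotp (A^T *m y) x.
Proof. by rewrite dotpC dotp_mull dotpC. Qed.

Lemma mulmx_delta n (A : 'M[R]_n) i j :
  A i j = dotp (delta_mx i 0) (A *m delta_mx j 0).
Proof. by rewrite dotpE trmx_delta mulmxA -rowE -colE !mxE. Qed.

End DotProduct.

(** * Positive semidefinite square roots *)

Section SquareRoot.
Context {R : realType}.

Lemma is_psdD n (A B : 'M[R]_n) : is_psd A -> is_psd B -> is_psd (A + B).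
Proof.
move=> [As A0] [Bs B0]; split; first by rewrite linearD/= As Bs.
by move=> v; rewrite mulmxDl dotpDl addr_ge0.
Qed.

Lemma is_psdZ n (c : R) (A : 'M[R]_n) : 0 <= c -> is_psd A -> is_psd (c *: A).
Proof.
move=> c0 [As A0]; split; first by rewrite linearZ/= As.
by move=> v; rewrite -scalemxAl dotpZl mulr_ge0.
Qed.

Lemma is_psd0 n : is_psd (0 : 'M[R]_n).
Proof. by split=> [|v]; rewrite ?trmx0// mul0mx dotp0l. Qed.

Lemma is_psd1 n : is_psd (1%:M : 'M[R]_n).
Proof. by split=> [|v]; rewrite ?trmx1// mul1mx dotp_ge0. Qed.

Lemma is_psd_conj n k (A : 'M[R]_n) (S : 'M[R]_(n, k)) :
  is_psd A -> is_psd (S^T *m A *m S).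
Proof.
move=> [As A0]; split; first by rewrite !trmx_mul trmxK As mulmxA.
by move=> v; rewrite -!mulmxA dotp_mull trmxK; exact: A0.
Qed.

Lemma is_psd_sandwich n (A S : 'M[R]_n) :
  is_psd A -> is_psd S -> is_psd (S *m A *m S).
Proof. by move=> Ap Sp; have := is_psd_conj S Ap; rewrite (proj1 Sp). Qed.

Lemma is_psd_pow n (B : 'M[R]_n) j : is_psd B -> is_psd (B ^+ j).
Proof.
move=> Bp; elim/ltn_ind: j => -[|[|j]] IH; first exact: is_psd1.
  by rewrite expr1.
by rewrite exprS exprSr mulrA; exact: is_psd_sandwich (IH _ _) Bp.
Qed.

(** Polynomials in B with nonnegative coefficients.  They are all positive
    semidefinite when B is ([pospoly_psd]) and closed under products, whereas a
    product of positive semidefinite matrices need not be so; this is what makes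
    the iteration below monotone. *)
Inductive pospoly n (B : 'M[R]_n) : 'M[R]_n -> Prop :=
| pospoly0 : pospoly B 0
| pospolyD c j M : 0 <= c -> pospoly B M -> pospoly B (c *: B ^+ j + M).

Lemma pospoly_psd n (B M : 'M[R]_n) : is_psd B -> pospoly B M -> is_psd M.
Proof.
move=> Bp; elim=> [|c j {}M c0 _ IH]; first exact: is_psd0.
by apply: is_psdD => //; apply: is_psdZ => //; exact: is_psd_pow.
Qed.

Lemma pospoly_add n (B M M' : 'M[R]_n) :
  pospoly B M -> pospoly B M' -> pospoly B (M + M').
Proof.
move=> + PM'; elim=> [|c j {}M c0 _ IH]; first by rewrite add0r.
by rewrite -addrA; exact: pospolyD.
Qed.

Lemma pospoly_scale n (B M : 'M[R]_n) c :
  0 <= c -> pospoly B M -> pospoly B (c *: M).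
Proof.
move=> c0; elim=> [|a j {}M a0 _ IH]; first by rewrite scaler0; exact: pospoly0.
by rewrite scalerDr scalerA; apply: pospolyD => //; exact: mulr_ge0.
Qed.

Lemma pospoly_mul n (B M M' : 'M[R]_n) :
  pospoly B M -> pospoly B M' -> pospoly B (M *m M').
Proof.
move=> + PM'; elim=> [|c j {}M c0 _ IH]; first by rewrite mul0mx; exact: pospoly0.
rewrite mulmxDl; apply: pospoly_add => //; elim: PM' {IH} => [|a k {}M' a0 _ IH].
  by rewrite mulmx0; exact: pospoly0.
rewrite mulmxDr -scalemxAl -scalemxAr scalerA -[_ ^+ j *m _]exprD; apply: pospolyD => //.
exact: mulr_ge0.
Qed.

Lemma pospoly_id n (B : 'M[R]_n) : pospoly B B.
Proof.
have := @pospolyD n B 1 1 0 ler01 (pospoly0 _).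
by rewrite addr0 scale1r expr1.
Qed.

(** The classical iteration whose limit Y solves 2 Y = B + Y^2, that is
    (1 - Y)^2 = 1 - B. *)
Fixpoint sqrt_iter n (B : 'M[R]_n) (k : nat) : 'M[R]_n :=
  if k is k'.+1 then 2^-1 *: (B + sqrt_iter B k' *m sqrt_iter B k') else 0.

Lemma half_ge0 : 0 <= 2^-1 :> R. Proof. by rewrite invr_ge0 ler0n. Qed.

Lemma sqrt_iter_pos n (B : 'M[R]_n) k : pospoly B (sqrt_iter B k).
Proof.
elim: k => [|k IH] /=; first exact: pospoly0.
apply: pospoly_scale; first exact: half_ge0.
by apply: pospoly_add; [exact: pospoly_id|exact: pospoly_mul].
Qed.

(** From Y'^2 - Y^2 = (Y' - Y) Y' + Y (Y' - Y), the increments inherit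
    nonnegative coefficients. *)
Lemma sqrt_iter_step n (B : 'M[R]_n) k :
  pospoly B (sqrt_iter B k.+1 - sqrt_iter B k).
Proof.
elim: k => [|k IH].
  rewrite /= mul0mx addr0 subr0.
  by apply: pospoly_scale; [exact: half_ge0|exact: pospoly_id].
set Y := sqrt_iter B k in IH *; set Y' := sqrt_iter B k.+1 in IH *.
have -> : sqrt_iter B k.+2 - Y' = 2^-1 *: ((Y' - Y) *m Y' + Y *m (Y' - Y)).
  rewrite {2}/Y' /= -/Y' -/Y -scalerBr; congr (_ *: _).
  rewrite mulmxBl mulmxBr addrA subrK opprD addrACA subrr add0r.
  by [].
apply: pospoly_scale; first exact: half_ge0.
by apply: pospoly_add; apply: pospoly_mul => //; exact: sqrt_iter_pos.
Qed.

(** A sum of sandwiches, where the factorization (1 - Y)(1 + Y) would leave the sign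
    of a product to be determined. *)
Lemma is_psd_one_minus_sqr n (Y : 'M[R]_n) :
  is_psd Y -> is_psd (1%:M - Y) -> is_psd (1%:M - Y *m Y).
Proof.
move=> Yp Zp.
have -> : 1%:M - Y *m Y =
    (1%:M - Y) + (Y *m (1%:M - Y) *m Y + (1%:M - Y) *m Y *m (1%:M - Y)).
  rewrite !mulmxBr !mulmxBl !mul1mx !mulmx1.
  move: (Y *m Y) (Y *m Y *m Y) => a b.
  by apply/matrixP => i j; rewrite !mxE; ring.
by apply: is_psdD => //; apply: is_psdD; exact: is_psd_sandwich.
Qed.

Lemma sqrt_iter_le1 n (B : 'M[R]_n) k :
  is_psd B -> is_psd (1%:M - B) -> is_psd (1%:M - sqrt_iter B k).
Proof.
move=> Bp Zp; elim: k => [|k IH] /=; first by rewrite subr0; exact: is_psd1.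
set Y := sqrt_iter B k in IH *.
have -> : 1%:M - 2^-1 *: (B + Y *m Y) =
   2^-1 *: ((1%:M - B) + (1%:M - Y *m Y)).
  apply/matrixP => i j; rewrite !mxE; set s := \sum_(_ < _) _.
  by field.
apply: is_psdZ; first exact: half_ge0.
apply: is_psdD => //; apply: is_psd_one_minus_sqr => //.
by apply: pospoly_psd Bp _; exact: sqrt_iter_pos.
Qed.

End SquareRoot.

Section SquareRootLimit.
Context {R : realType}.

(** Entrywise convergence, which avoids any reference to a norm on matrices. *)
Definition mxcvg n m (A_ : nat -> 'M[R]_(n, m)) (A : 'M[R]_(n, m)) :=
  forall i j, A_ k i j @[k --> \oo] --> A i j.

Lemma mxcvg_unique n m (A_ : nat -> 'M[R]_(n, m)) A B :
  mxcvg A_ A -> mxcvg A_ B -> A = B.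
Proof.
move=> hA hB; apply/matrixP => i j.
by apply: (@cvg_unique _ (@norm_hausdorff _ R) _ _ _ _ (hA i j) (hB i j)).
Qed.

Lemma mxcvg_cst n m (A : 'M[R]_(n, m)) : mxcvg (fun=> A) A.
Proof. by move=> i j; exact: cvg_cst. Qed.

Lemma mxcvgD n m (A_ B_ : nat -> 'M[R]_(n, m)) A B :
  mxcvg A_ A -> mxcvg B_ B -> mxcvg (fun k => A_ k + B_ k) (A + B).
Proof.
move=> hA hB i j; rewrite mxE.
by under eq_fun do rewrite mxE; apply: cvgD.
Qed.

Lemma mxcvgZ n m (c : R) (A_ : nat -> 'M[R]_(n, m)) A :
  mxcvg A_ A -> mxcvg (fun k => c *: A_ k) (c *: A).
Proof.
move=> hA i j; rewrite mxE.
by under eq_fun do rewrite mxE; apply: cvgMl_tmp.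
Qed.

Lemma mxcvgM n m p (A_ : nat -> 'M[R]_(n, m)) (B_ : nat -> 'M[R]_(m, p)) A B :
  mxcvg A_ A -> mxcvg B_ B -> mxcvg (fun k => A_ k *m B_ k) (A *m B).
Proof.
move=> hA hB i j; rewrite mxE.
under eq_fun do rewrite mxE.
by apply: (cvg_big add_continuous) => k _; apply: cvgM.
Qed.

Lemma mxcvg_tr n m (A_ : nat -> 'M[R]_(n, m)) A :
  mxcvg A_ A -> mxcvg (fun k => (A_ k)^T) A^T.
Proof. by move=> hA i j; rewrite mxE; under eq_fun do rewrite mxE; exact: hA. Qed.

Lemma mxcvg_shift n m (A_ : nat -> 'M[R]_(n, m)) A :
  mxcvg A_ A -> mxcvg (fun k => A_ k.+1) A.
Proof.
move=> hA i j; have := hA i j.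
by rewrite -(@cvg_shiftS R (fun k => A_ k i j)).
Qed.

Lemma is_psd_cvg n (A_ : nat -> 'M[R]_n) A :
  (forall k, is_psd (A_ k)) -> mxcvg A_ A -> is_psd A.
Proof.
move=> A_p hA; split.
  apply: (mxcvg_unique (mxcvg_tr hA)).
  by under eq_fun do rewrite (proj1 (A_p _)).
move=> v; rewrite dotpE.
have := mxcvgM (mxcvg_tr (mxcvgM hA (@mxcvg_cst _ _ v))) (@mxcvg_cst _ _ v).
move=> /(_ 0 0) cv; rewrite -(cvg_lim _ cv)//.
apply: limr_ge; first by apply/cvg_ex; eexists; exact: cv.
by apply: nearW => k; rewrite -dotpE; case: (A_p k).
Qed.

Lemma mx_polarization n (A : 'M[R]_n) i j : A^T = A ->
  A i j = 2^-1 * (dotp (A *m (delta_mx i 0 + delta_mx j 0))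
                       (delta_mx i 0 + delta_mx j 0)
    - dotp (A *m delta_mx i 0) (delta_mx i 0)
    - dotp (A *m delta_mx j 0) (delta_mx j 0)).
Proof.
move=> As.
rewrite mulmxDr dotpDl !dotpDr -!(dotpC (delta_mx _ _)) -!mulmx_delta.
have -> : A j i = A i j by rewrite -[in LHS]As mxE.
by field.
Qed.

(** The quadratic forms of the iterates increase and are bounded by |v|^2;
    polarization turns their convergence into convergence of the entries. *)
Lemma sqrt_iter_cvg n (B : 'M[R]_n) :
  is_psd B -> is_psd (1%:M - B) -> exists Y, mxcvg (sqrt_iter B) Y.
Proof.
move=> Bp Zp.
have q_cvg v : cvgn (fun k => dotp (sqrt_iter B k *m v) v).
  apply: nondecreasing_is_cvgn.
    apply/nondecreasing_seqP => k.
    have [_ /(_ v)] := pospoly_psd Bp (sqrt_iter_step B k).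
    by rewrite mulmxBl dotpDl dotpNl subr_ge0.
  exists (dotp v v) => _ [k _ <-].
  have [_ /(_ v)] := sqrt_iter_le1 k Bp Zp.
  by rewrite mulmxBl mul1mx dotpDl dotpNl subr_ge0.
exists (\matrix_(i, j) limn (fun k => sqrt_iter B k i j)) => i j.
rewrite mxE; apply/cvg_ex.
eexists.
under eq_fun => k.
  rewrite (@mx_polarization _ (sqrt_iter B k)); last first.
    by case: (pospoly_psd Bp (sqrt_iter_pos B k)).
  over.
apply: cvgMl_tmp; apply: cvgB; [apply: cvgB|]; exact: q_cvg.
Qed.

(** A bound of A by a multiple of the identity that is a measurable function of
    the entries; the summand 1 keeps it positive. *)
Definition sqrt_scale n (A : 'M[R]_n) : R := 1 + \sum_i \sum_j `|A i j|.

Lemma sqrt_scale_gt0 n (A : 'M[R]_n) : 0 < sqrt_scale A.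
Proof. by rewrite ltr_pwDl// sumr_ge0// => i _; rewrite sumr_ge0. Qed.

Lemma sqrt_scale_ge n (A : 'M[R]_n) : is_psd A ->
  is_psd ((sqrt_scale A)%:M - A).
Proof.
move=> [As A0]; split; first by rewrite linearB/= tr_scalar_mx As.
move=> v; rewrite mulmxBl dotpDl dotpNl subr_ge0 mul_scalar_mx dotpZl.
have comp_le i : v i 0 ^+ 2 <= dotp v v.
  rewrite /dotp (bigD1 i)//= -expr2 lerDl sumr_ge0// => j _.
  by rewrite -expr2 sqr_ge0.
have prod_le i j : `|v i 0| * `|v j 0| <= dotp v v.
  have := comp_le i; have := comp_le j.
  rewrite -!(real_normK (num_real (v _ _))).
  move: (normr_ge0 (v i 0)) (normr_ge0 (v j 0)).
  move: `|v i 0| `|v j 0| => a b a0 b0; nra.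
apply: (@le_trans _ _ ((\sum_i \sum_j `|A i j|) * dotp v v)); last first.
  by rewrite ler_wpM2r ?dotp_ge0// lerDr.
rewrite mulr_suml {1}/dotp; apply: ler_sum => i _.
rewrite !mxE !mulr_suml; apply: ler_sum => j _.
apply: le_trans (ler_norm _) _; rewrite !normrM -mulrA.
by rewrite ler_wpM2l// mulrC prod_le.
Qed.

Definition sqrt_arg n (A : 'M[R]_n) : 'M[R]_n :=
  1%:M - (sqrt_scale A)^-1 *: A.

Definition sqrt_approx n (A : 'M[R]_n) (k : nat) : 'M[R]_n :=
  Num.sqrt (sqrt_scale A) *: (1%:M - sqrt_iter (sqrt_arg A) k).

(** Rescaling brings A between 0 and 1, where the iteration applies. *)
Lemma sqrt_approx_cvg n (A : 'M[R]_n) : is_psd A ->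
  exists S, [/\ mxcvg (sqrt_approx A) S, is_psd S & S *m S = A].
Proof.
move=> Ap; set c := sqrt_scale A.
have c0 : 0 < c := sqrt_scale_gt0 A.
have Bp : is_psd (sqrt_arg A).
  rewrite (_ : sqrt_arg A = c^-1 *: (c%:M - A)).
    by apply: is_psdZ; [rewrite invr_ge0 ltW|exact: sqrt_scale_ge].
  by rewrite scalerBr scale_scalar_mx mulVf// gt_eqF.
have Zp : is_psd (1%:M - sqrt_arg A).
  by rewrite opprB addrC subrK; apply: is_psdZ => //; rewrite invr_ge0 ltW.
have [Y hY] := sqrt_iter_cvg Bp Zp.
have hZ : mxcvg (fun k => 1%:M - sqrt_iter (sqrt_arg A) k) (1%:M - Y).
  apply: mxcvgD; first exact: mxcvg_cst.
  by under eq_fun do rewrite -scaleN1r; rewrite -scaleN1r; exact: mxcvgZ.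
exists (Num.sqrt c *: (1%:M - Y)); split.
- exact: mxcvgZ.
- apply: is_psdZ; first exact: sqrtr_ge0.
  by apply: is_psd_cvg hZ => k; exact: sqrt_iter_le1.
- have YE : Y = 2^-1 *: (sqrt_arg A + Y *m Y).
    apply: (mxcvg_unique (mxcvg_shift hY)).
    by apply: mxcvgZ; apply: mxcvgD; [exact: mxcvg_cst|exact: mxcvgM].
  have -> : (Num.sqrt c *: (1%:M - Y)) *m (Num.sqrt c *: (1%:M - Y)) =
      c *: (1%:M - 2 *: Y + Y *m Y).
    rewrite -scalemxAl -scalemxAr scalerA -expr2 sqr_sqrtr ?ltW//.
    rewrite mulmxBl mul1mx mulmxBr mulmx1; congr (_ *: _).
    move: (Y *m Y) => Y2; apply/matrixP => i j; rewrite !mxE; ring.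
  rewrite {1}YE scalerA divff ?pnatr_eq0// scale1r /sqrt_arg opprD addrA subrK.
  by rewrite opprB addrC subrK scalerA divff ?scale1r// gt_eqF.
Qed.

Lemma mxcvg_comm n (A_ : nat -> 'M[R]_n) A S :
  (forall k, S *m A_ k = A_ k *m S) -> mxcvg A_ A -> S *m A = A *m S.
Proof.
move=> SA hA; apply: (mxcvg_unique (mxcvgM (@mxcvg_cst _ _ S) hA)).
under eq_fun do rewrite SA.
exact: mxcvgM hA (@mxcvg_cst _ _ S).
Qed.

Lemma sqrt_iter_comm n (B S : 'M[R]_n) k :
  S *m B = B *m S -> S *m sqrt_iter B k = sqrt_iter B k *m S.
Proof.
move=> SB; elim: k => [|k IH] /=; first by rewrite mulmx0 mul0mx.
rewrite -scalemxAl -scalemxAr mulmxDl mulmxDr SB; congr (_ *: (_ + _)).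
by rewrite mulmxA IH -!mulmxA IH.
Qed.

Lemma sqrt_approx_comm n (A S : 'M[R]_n) k :
  S *m A = A *m S -> S *m sqrt_approx A k = sqrt_approx A k *m S.
Proof.
move=> SA; rewrite -scalemxAl -scalemxAr mulmxBl mulmxBr mul1mx mulmx1.
rewrite sqrt_iter_comm// mulmxBl mulmxBr mul1mx mulmx1.
by rewrite -scalemxAl -scalemxAr SA.
Qed.

Lemma is_psd_eq0 n (A : 'M[R]_n) :
  is_psd A -> (forall v, dotp (A *m v) v = 0) -> A = 0.
Proof.
move=> [As _] A0; apply/matrixP => i j.
by rewrite mx_polarization// !A0 !subrr mulr0 mxE.
Qed.

Lemma is_psd_add_eq0 n (A B : 'M[R]_n) :
  is_psd A -> is_psd B -> A + B = 0 -> A = 0.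
Proof.
move=> Ap Bp AB0; apply: is_psd_eq0 => // v; apply/eqP.
rewrite eq_le (proj2 Ap) andbT.
have : dotp ((A + B) *m v) v = 0 by rewrite AB0 mul0mx dotp0l.
rewrite mulmxDl dotpDl => /eqP; rewrite addr_eq0 => /eqP ->.
by rewrite oppr_le0 (proj2 Bp).
Qed.

Lemma sym_cube_eq0 n (A : 'M[R]_n) : A^T = A -> A *m A *m A = 0 -> A = 0.
Proof.
move=> As A3.
have sq_eq0 (B : 'M[R]_n) : B^T = B -> B *m B = 0 -> B = 0.
  move=> Bs B2; apply/matrixP => i j.
  have /dotp_eq0 : dotp (B *m delta_mx j 0) (B *m delta_mx j 0) = 0.
    by rewrite dotp_mull Bs mulmxA B2 mul0mx dotp0r.
  by rewrite mulmx_delta => ->; rewrite dotp0r mxE.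
apply: (sq_eq0 _ As); apply: sq_eq0; first by rewrite trmx_mul As.
by rewrite mulmxA A3 mul0mx.
Qed.

(** With D = S - S', commutation and S^2 = S'^2 give D (S + S') = 0, so the
    positive semidefinite matrices D S D and D S' D add up to 0 and vanish both,
    whence D^3 = D S D - D S' D = 0. *)
Lemma psd_sqrt_unique n (S S' : 'M[R]_n) : is_psd S -> is_psd S' ->
  S *m S' = S' *m S -> S *m S = S' *m S' -> S = S'.
Proof.
move=> Sp S'p SS' S2; apply/eqP; rewrite -subr_eq0; apply/eqP.
set D := S - S'.
have Ds : D^T = D by rewrite linearB/= (proj1 Sp) (proj1 S'p).
have Dp X : is_psd X -> is_psd (D *m X *m D).
  by move=> Xp; have := is_psd_conj D Xp; rewrite Ds.
have D0 : D *m (S + S') = 0.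
  rewrite mulmxBl !mulmxDr SS' S2.
  by apply/eqP; rewrite subr_eq0 addrC.
have E : D *m S *m D + D *m S' *m D = 0.
  by rewrite -mulmxDl -mulmxDr D0 mul0mx.
have E1 := is_psd_add_eq0 (Dp _ Sp) (Dp _ S'p) E.
move: (E); rewrite E1 add0r => E2.
apply: (sym_cube_eq0 Ds).
have -> : D *m D *m D = D *m S *m D - D *m S' *m D.
  by rewrite -mulmxBl -mulmxBr.
by rewrite E1 E2 subrr.
Qed.

(** Any root S of A commutes with A, hence with the iterates and with their
    limit, so uniqueness among commuting roots is enough. *)
Lemma psd_sqrtP n (A : 'M[R]_n) : is_psd A ->
  [/\ is_psd (psd_sqrt A), psd_sqrt A *m psd_sqrt A = A &
      mxcvg (sqrt_approx A) (psd_sqrt A)].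
Proof.
move=> Ap; have [S [hS Sp S2]] := sqrt_approx_cvg Ap.
have [Tp T2] : [set S | is_psd S /\ S *m S = A] (psd_sqrt A).
  by apply: (@xgetPex _ 0 [set S | is_psd S /\ S *m S = A]); exists S.
suff <- : S = psd_sqrt A by [].
apply: psd_sqrt_unique => //; last by rewrite S2 T2.
apply/esym; apply: mxcvg_comm hS => k.
by apply: sqrt_approx_comm; rewrite -{2 3}T2 mulmxA.
Qed.

Lemma psd_sqrt0 n : psd_sqrt (0 : 'M[R]_n) = 0.
Proof.
have [[Ss _] S2 _] := psd_sqrtP (@is_psd0 R n).
by apply: sym_cube_eq0; rewrite ?S2 ?mul0mx.
Qed.

End SquareRootLimit.

(** * Integrable and square integrable functions *)

Section ScalarIntegrals.
Context {R : realType}.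
Notation mu := (@lebesgue_measure R).
Notation meas := (@measurable_fun _ _ (measurableTypeR R) R).
Implicit Types (D : set R) (f g h : R -> R).

(** The scalar classes behind [Lmx], on an arbitrary measurable set. *)
Definition L1 D f := mu.-integrable D (EFin \o f).
Definition L2 D f := meas D f /\ L1 D (fun t => f t ^+ 2).
Definition bdd D f := exists C : R, forall t, D t -> `|f t| <= C.

Lemma L1_meas D f : L1 D f -> meas D f.
Proof. by move=> /measurable_int /measurable_EFinP. Qed.

Context (D : set R) (mD : @measurable _ (measurableTypeR R) D).

Lemma L1_ext f g : (forall t, D t -> f t = g t) -> L1 D f -> L1 D g.
Proof.
by move=> fg; apply: (eq_integrable mD) => t; rewrite inE /= => /fg ->.
Qed.

Lemma L1D f g : L1 D f -> L1 D g -> L1 D (fun t => f t + g t).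
Proof. exact: integrableD. Qed.

Lemma L1Z c f : L1 D f -> L1 D (fun t => c * f t).
Proof. by move=> If; exact: (integrableZl mD c If). Qed.

Lemma L1_0 : L1 D (fun=> 0).
Proof. exact: integrable0. Qed.

Lemma L1_sum (I : Type) (s : seq I) (F : I -> R -> R) :
  (forall i, L1 D (F i)) -> L1 D (fun t => \sum_(i <- s) F i t).
Proof.
move=> IF; elim: s => [|i s IH].
  by apply: L1_ext L1_0 => t _; rewrite big_nil.
apply: L1_ext (L1D (IF i) IH) => t _; by rewrite big_cons.
Qed.

Lemma L1S f E : @measurable _ (measurableTypeR R) E -> E `<=` D -> L1 D f -> L1 E f.
Proof. by move=> mE ED; exact: integrableS. Qed.

Lemma L1_le f g : meas D f -> L1 D g ->
  (forall t, D t -> `|f t| <= g t) -> L1 D f.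
Proof.
move=> mf Ig fg; apply: (le_integrable mD _ _ Ig); first exact/measurable_EFinP.
move=> t Dt /=; rewrite lee_fin (le_trans (fg t Dt))// ler_norm//.
Qed.

Lemma L1_norm f : L1 D f -> L1 D (fun t => `|f t|).
Proof. exact: integrable_norm. Qed.

Lemma L1_bddM f g : meas D f -> bdd D f -> L1 D g ->
  L1 D (fun t => f t * g t).
Proof.
move=> mf [C fC] Ig; apply: (@L1_le _ (fun t => C * `|g t|)).
- by apply: measurable_funM => //; exact: L1_meas.
- exact/L1Z/L1_norm.
- by move=> t Dt; rewrite normrM ler_wpM2r// fC.
Qed.

Lemma L1_L2M f g : L2 D f -> L2 D g -> L1 D (fun t => f t * g t).
Proof.
move=> [mf If] [mg Ig]; apply: (@L1_le _ (fun t => f t ^+ 2 + g t ^+ 2)).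
- exact: measurable_funM.
- exact: L1D.
- move=> t _; rewrite normrM -(real_normK (num_real (f t))).
  rewrite -(real_normK (num_real (g t))).
  by move: `|f t| `|g t| (normr_ge0 (f t)) (normr_ge0 (g t)) => x y; nra.
Qed.

Lemma L2_le f g : meas D f -> L1 D g ->
  (forall t, D t -> f t ^+ 2 <= g t) -> L2 D f.
Proof.
move=> mf Ig fg; split=> //; apply: L1_le Ig _; first exact: measurable_funX.
by move=> t Dt; rewrite ger0_norm ?sqr_ge0// fg.
Qed.

Lemma L2D f g : L2 D f -> L2 D g -> L2 D (fun t => f t + g t).
Proof.
move=> [mf If] [mg Ig].
apply: (@L2_le _ (fun t => 2 * (f t ^+ 2 + g t ^+ 2))).
- exact: measurable_funD.
- exact/L1Z/L1D.
- by move=> t _; have := sqr_ge0 (f t - g t); lra.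
Qed.

Lemma L2Z c f : L2 D f -> L2 D (fun t => c * f t).
Proof.
move=> [mf If]; apply: (@L2_le _ (fun t => c ^+ 2 * f t ^+ 2)).
- exact: measurable_funM.
- exact: L1Z.
- by move=> t _; rewrite exprMn.
Qed.

Lemma L2_0 : L2 D (fun=> 0).
Proof. by split=> //; apply: L1_ext L1_0 => t _; rewrite expr0n. Qed.

Lemma L2_ext f g : (forall t, D t -> f t = g t) -> L2 D f -> L2 D g.
Proof.
move=> fg [mf If]; split.
  by apply: eq_measurable_fun mf => t; rewrite inE => /fg.
by apply: L1_ext If => t /fg ->.
Qed.

Lemma L2_sum (I : Type) (s : seq I) (F : I -> R -> R) :
  (forall i, L2 D (F i)) -> L2 D (fun t => \sum_(i <- s) F i t).
Proof.
move=> IF; elim: s => [|i s IH].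
  by apply: L2_ext L2_0 => t _; rewrite big_nil.
apply: L2_ext (L2D (IF i) IH) => t _; by rewrite big_cons.
Qed.

Lemma L2_bddM f g : meas D f -> bdd D f -> L2 D g ->
  L2 D (fun t => f t * g t).
Proof.
move=> mf [C fC] [mg Ig]; apply: (@L2_le _ (fun t => C ^+ 2 * g t ^+ 2)).
- exact: measurable_funM.
- exact: L1Z.
- move=> t Dt; rewrite exprMn ler_wpM2r ?sqr_ge0//.
  by rewrite -(real_normK (num_real (f t))) ler_sqr ?nnegrE ?(le_trans _ (fC t Dt))// fC.
Qed.

Lemma bddM f g : bdd D f -> bdd D g -> bdd D (fun t => f t * g t).
Proof.
move=> [C fC] [C' gC]; exists (C * C') => t Dt.
by rewrite normrM ler_pM ?fC ?gC.
Qed.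

Lemma bdd_sum (I : Type) (s : seq I) (F : I -> R -> R) :
  (forall i, bdd D (F i)) -> bdd D (fun t => \sum_(i <- s) F i t).
Proof.
move=> IF; elim: s => [|i s [C HC]].
  by exists 0 => t _; rewrite big_nil normr0.
have [C' HC'] := IF i; exists (C' + C) => t Dt; rewrite big_cons.
by rewrite (le_trans (ler_normD _ _))// lerD ?HC ?HC'.
Qed.

Lemma itgZ c f : L1 D f -> \int[mu]_(t in D) (c * f t) = c * \int[mu]_(t in D) f t.
Proof. exact: RintegralZl. Qed.

Lemma itgD f g : L1 D f -> L1 D g ->
  \int[mu]_(t in D) (f t + g t) = \int[mu]_(t in D) f t + \int[mu]_(t in D) g t.
Proof. exact: RintegralD. Qed.

Lemma itg0 : \int[mu]_(t in D) (0 : R) = 0.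
Proof. by rewrite Rintegral_cst// mul0r. Qed.

Lemma itg_ext f g : (forall t, D t -> f t = g t) ->
  \int[mu]_(t in D) f t = \int[mu]_(t in D) g t.
Proof. by move=> fg; apply: eq_Rintegral => t; rewrite inE; exact: fg. Qed.

Lemma itg_sum (I : Type) (s : seq I) (F : I -> R -> R) :
  (forall i, L1 D (F i)) ->
  \int[mu]_(t in D) (\sum_(i <- s) F i t) = \sum_(i <- s) \int[mu]_(t in D) F i t.
Proof.
move=> IF; elim: s => [|i s IH].
  rewrite big_nil -[RHS]itg0; apply: itg_ext => t _; by rewrite big_nil.
rewrite big_cons -IH -itgD//; last exact: L1_sum.
by apply: itg_ext => t _; rewrite big_cons.
Qed.

Lemma itg_ae f g : L1 D f -> L1 D g ->
  {ae mu, forall t, D t -> f t = g t} ->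
  \int[mu]_(t in D) f t = \int[mu]_(t in D) g t.
Proof.
move=> If Ig fg; congr fine; apply: ae_eq_integral => //.
- exact: measurable_int If.
- exact: measurable_int Ig.
- have mu_ae : Filter (almost_everywhere mu) by exact: (ae_filter_ringOfSetsType mu).
  by apply: (@filterS _ _ mu_ae _ _ _ fg) => t fgt Dt /=; rewrite fgt.
Qed.

Lemma le_itg f g : L1 D f -> L1 D g -> (forall t, D t -> f t <= g t) ->
  \int[mu]_(t in D) f t <= \int[mu]_(t in D) g t.
Proof. exact: le_Rintegral. Qed.

Lemma norm_itg_le f g : L1 D f -> L1 D g -> (forall t, D t -> `|f t| <= g t) ->
  `|\int[mu]_(t in D) f t| <= \int[mu]_(t in D) g t.
Proof.
move=> If Ig fg; apply: le_trans (le_normr_Rintegral mD If) _.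
by apply: le_itg => //; exact: L1_norm.
Qed.

End ScalarIntegrals.

Section LebesgueClasses.
Context {R : realType}.
Notation mu := (@lebesgue_measure R).
Notation meas := (@measurable_fun _ _ (measurableTypeR R) R).

Lemma Lmx1P m n (a b : R) (A : R -> 'M[R]_(m, n)) :
  Lmx 1 a b A <-> forall i j, L1 `[a, b] (fun t => A t i j).
Proof.
have mab : @measurable _ (measurableTypeR R) `[a, b]%classic by exact: measurable_itv.
split=> h i j; have := h i j.
  rewrite Lfun1_integrable -restrict_EFin => h'.
  exact: (proj2 (integrable_mkcond _ mab) h').
rewrite Lfun1_integrable -restrict_EFin => h'.
exact: (proj1 (integrable_mkcond _ mab) h').
Qed.

Lemma Lmx2P m n (a b : R) (A : R -> 'M[R]_(m, n)) :
  Lmx 2%:E a b A <-> forall i j, L2 `[a, b] (fun t => A t i j).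
Proof.
have mab : @measurable _ (measurableTypeR R) `[a, b]%classic by exact: measurable_itv.
split=> h i j.
  have := h i j; set f := fun t => A t i j => hf.
  have mf : meas `[a, b] f.
    apply/(@measurable_restrictT _ _ _ _ `[a, b]%classic) => //.
    by have /sub_Lfun_mfun := hf; rewrite inE.
  split=> //.
  have := Lfun2_integrable_sqr hf.
  rewrite (_ : EFin \o _ = (EFin \o (fun t => f t ^+ 2)) \_ `[a, b]); last first.
    rewrite restrict_EFin; apply/funext => t /=; congr EFin.
    by rewrite !patchE; case: ifPn => //; rewrite expr0n.
  by move=> h'; exact: (proj2 (integrable_mkcond _ mab) h').
have [mf If] := h i j; set f := fun t => A t i j in mf If *.
rewrite inE; apply/andP; split; rewrite inE /=.
  exact/(@measurable_restrictT _ _ _ _ `[a, b]%classic).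
rewrite /finite_norm unlock.
apply: poweR_lty.
have /integrableP[_] : mu.-integrable setT (EFin \o (fun t => (f \_ `[a, b]) t ^+ 2)).
  rewrite (_ : EFin \o _ = (EFin \o (fun t => f t ^+ 2)) \_ `[a, b]).
    exact: (proj1 (integrable_mkcond _ mab) If).
  rewrite restrict_EFin; apply/funext => t /=; congr EFin.
  by rewrite !patchE; case: ifPn => //; rewrite expr0n.
apply: le_lt_trans; rewrite le_eqVlt; apply/orP; left; apply/eqP.
apply: eq_integral => t _ /=.
by rewrite powR_mulrn// normrX.
Qed.

End LebesgueClasses.

(** * Absolutely continuous functions *)

Section AbsolutelyContinuous.
Context {R : realType}.
Notation mu := (@lebesgue_measure R).
Notation meas := (@measurable_fun _ _ (measurableTypeR R) R).

Lemma itv_meas (a b : R) : @measurable _ (measurableTypeR R) `[a, b]%classic.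
Proof. exact: measurable_itv. Qed.
Hint Resolve itv_meas : core.

Lemma itg_EFin (D : set R) (f : R -> R) : @measurable _ (measurableTypeR R) D ->
  L1 D f -> (\int[mu]_(t in D) (f t)%:E)%E = (\int[mu]_(t in D) f t)%:E.
Proof. by move=> mD If; rewrite fineK//; exact: integrable_fin_num. Qed.

Lemma itv_subl (a b t : R) : t \in `[a, b] -> `[a, t]%classic `<=` `[a, b]%classic.
Proof.
move=> + s /=; rewrite !in_itv /= => /andP[_ tb] /andP[as_ st].
by rewrite as_ (le_trans st).
Qed.

Lemma itv_subr (a b t : R) : t \in `[a, b] -> `[t, b]%classic `<=` `[a, b]%classic.
Proof.
move=> + s /=; rewrite !in_itv /= => /andP[at_ tb] /andP[ts ->].
by rewrite andbT (le_trans at_).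
Qed.

Lemma L1_itvl (a b t : R) f : t \in `[a, b] -> L1 `[a, b] f -> L1 `[a, t] f.
Proof. by move=> tab; apply: L1S => //; exact: itv_subl. Qed.

Lemma L1_itvr (a b t : R) f : t \in `[a, b] -> L1 `[a, b] f -> L1 `[t, b] f.
Proof. by move=> tab; apply: L1S => //; exact: itv_subr. Qed.

Lemma itg_split (a b t : R) f : t \in `[a, b] -> L1 `[a, b] f ->
  \int[mu]_(x in `[a, b]) f x =
  \int[mu]_(x in `[a, t]) f x + \int[mu]_(x in `[t, b]) f x.
Proof.
move=> tab If; have /andP[at_ tb] : (a <= t) && (t <= b) by rewrite in_itv in tab.
have := @Rintegral_itvB R f (BLeft a) (BRight b) t If.
rewrite !bnd_simp => /(_ at_ tb) E.
rewrite -[\int[mu]_(x in `[t, b]) f x]Rintegral_itv_obnd_cbnd; last first.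
  apply: (@L1S _ _ (itv_meas t b) _ _ _ _ (L1_itvr tab If)); first exact: measurable_itv.
  by move=> s /=; rewrite !in_itv /= => /andP[/ltW -> ->].
by rewrite -E addrC subrK.
Qed.

Lemma cont_meas (a b : R) f : {within `[a, b], continuous f} -> meas `[a, b] f.
Proof. by move=> cf; apply: subspace_continuous_measurable_fun => //. Qed.

Lemma cont_bdd (a b : R) f : a <= b -> {within `[a, b], continuous f} ->
  bdd `[a, b] f.
Proof.
move=> ab cf; have [c _ fc] := EVT_max ab cf; have [c' _ fc'] := EVT_min ab cf.
exists (`|f c| + `|f c'|) => t tab; rewrite ler_norml; apply/andP; split.
  rewrite (le_trans _ (fc' t tab))// lerNl (le_trans (ler_norm _))// normrN.
  by rewrite lerDr.
by rewrite (le_trans (fc t tab))// (le_trans (ler_norm _))// lerDl.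
Qed.

Lemma cont_prim (a b : R) f : a <= b -> L1 `[a, b] f ->
  {within `[a, b], continuous (fun t => \int[mu]_(x in `[a, t]) f x)}.
Proof. by move=> ab If; exact: parameterized_integral_continuous ab If. Qed.

(** Fubini on the triangle a <= x <= t <= b. *)
Lemma itg_triangle (a b : R) f g : a <= b -> L1 `[a, b] f -> L1 `[a, b] g ->
  \int[mu]_(t in `[a, b]) (f t * \int[mu]_(x in `[a, t]) g x) =
  \int[mu]_(t in `[a, b]) (g t * \int[mu]_(x in `[t, b]) f x).
Proof.
move=> ab If Ig.
(* Fubini is applied on the whole plane to f(x) g(y) 1_{y <= x}, extended by 0. *)
pose f1 := f \_ `[a, b]; pose g1 := g \_ `[a, b].
have If1 : L1 setT f1.
  by rewrite /L1 -restrict_EFin; exact: (proj1 (integrable_mkcond _ (itv_meas a b)) If).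
have Ig1 : L1 setT g1.
  by rewrite /L1 -restrict_EFin; exact: (proj1 (integrable_mkcond _ (itv_meas a b)) Ig).
pose A : set (measurableTypeR R * measurableTypeR R) := [set z | z.2 <= z.1].
pose h (z : measurableTypeR R * measurableTypeR R) : \bar R :=
  (f1 z.1 * g1 z.2 * \1_A z)%:E.
have mA : measurable A.
  have := @measurable_fun_ler _ _ _ setT
    (fun z : measurableTypeR R * measurableTypeR R => z.2) (fun z => z.1)
    measurable_snd measurable_fst.
  move=> /(_ measurableT [set true]); rewrite setTI.
  rewrite (_ : _ @^-1` _ = A); first exact.
  by apply/seteqP; split=> z /=.
have mf1 : measurable_fun setT
    (fun z : measurableTypeR R * measurableTypeR R => f1 z.1).
  by apply: (measurableT_comp (L1_meas If1)); exact: measurable_fst.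
have mg1 : measurable_fun setT
    (fun z : measurableTypeR R * measurableTypeR R => g1 z.2).
  by apply: (measurableT_comp (L1_meas Ig1)); exact: measurable_snd.
have mh : measurable_fun setT h.
  apply/measurable_EFinP; apply: measurable_funM; first exact: measurable_funM.
  exact: measurable_indic.
have Ih : (mu \x mu)%E.-integrable setT h.
  apply: (proj2 (@integrable12ltyP _ _ _ _ _ mu mu h mh)).
  have nf : mu.-integrable setT (fun x => (`|f1 x|)%:E) := integrable_norm If1.
  have ng : mu.-integrable setT (fun x => (`|g1 x|)%:E) := integrable_norm Ig1.
  apply: (@le_lt_trans _ _
    (\int[mu]_x ((`|f1 x|)%:E * \int[mu]_y (`|g1 y|)%:E))%E).
    apply: ge0_le_integral => //.
    - by move=> x _; exact: integral_ge0.
    - apply: (@measurable_fun_fubini_tonelli_F _ _ _ _ _ mu (abse \o h)) => //.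
        exact: measurableT_comp.
      by move=> z; exact: abse_ge0.
    - exact: (emeasurable_funM (measurable_int _ nf) (measurable_cst _)).
    - move=> x _; rewrite -ge0_integralZl//; last exact: measurable_int ng.
      apply: ge0_le_integral => //.
      + by apply/measurable_EFinP; apply: measurableT_comp => //;
          apply/measurable_EFinP; exact: (measurableT_comp mh).
      + by apply: emeasurable_funM => //; exact: measurable_int ng.
      + move=> y _; rewrite /h /= -EFinM lee_fin !normrM ler_piMr//.
        by rewrite indicE; case: (_ \in _); rewrite ?normr1 ?normr0.
  rewrite ge0_integralZr//; last first.
  - exact: integral_ge0.
  - exact: measurable_int nf.
  apply: lte_mul_pinfty.
  - exact: integral_ge0.
  - exact: integrable_fin_num.
  - by case/integrableP: ng => _; under eq_integral do rewrite /= normr_id.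
have /= E := Fubini Ih.
have inI x : (x \in `[a, b]%classic) = (x \in `[a, b]) by rewrite mem_setE.
have E1 x : (\int[mu]_y h (x, y))%E =
    (((fun t => f t * \int[mu]_(x in `[a, t]) g x) \_ `[a, b]) x)%:E.
  rewrite patchE inI; case: ifPn => xab.
    rewrite Rintegral_mkcond.
    have Igx : L1 setT (g \_ `[a, x]).
      rewrite /L1 -restrict_EFin.
      exact: (proj1 (integrable_mkcond _ (itv_meas a x)) (L1_itvl xab Ig)).
    rewrite -itgZ// -itg_EFin//; last exact: L1Z.
    apply: eq_integral => y _; rewrite /h /f1 /= patchE inI xab -mulrA.
    congr (_ * _)%:E; rewrite indicE /g1 !patchE.
    have -> : ((x, y) \in A) = (y <= x) by apply/asboolP/idP.
    rewrite !mem_setE !in_itv /=; have /andP[ax xb] : (a <= x) && (x <= b) by rewrite in_itv in xab.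
    have [yx|yx] := leP y x; rewrite ?andbF ?mulr0//= mulr1 andbT.
    by rewrite (le_trans yx xb) andbT.
  rewrite integral0_eq// => y _.
  by rewrite /h /f1 patchE inI (negbTE xab) !mul0r.
have E2 y : (\int[mu]_x h (x, y))%E =
    (((fun t => g t * \int[mu]_(x in `[t, b]) f x) \_ `[a, b]) y)%:E.
  rewrite patchE inI; case: ifPn => yab.
    rewrite Rintegral_mkcond.
    have Ify : L1 setT (f \_ `[y, b]).
      rewrite /L1 -restrict_EFin.
      exact: (proj1 (integrable_mkcond _ (itv_meas y b)) (L1_itvr yab If)).
    rewrite -itgZ// -itg_EFin//; last exact: L1Z.
    apply: eq_integral => x _; rewrite /h /g1 /= [in X in _ * X * _]patchE inI yab.
    rewrite [_ * g y]mulrC -mulrA.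
    congr (_ * _)%:E; rewrite indicE /f1 !patchE.
    have -> : ((x, y) \in A) = (y <= x) by apply/asboolP/idP.
    rewrite !mem_setE !in_itv /=; have /andP[ay yb] : (a <= y) && (y <= b) by rewrite in_itv in yab.
    have [yx|yx] := leP y x; rewrite ?mulr0//= mulr1.
    by rewrite (le_trans ay yx).
  rewrite integral0_eq// => x _.
  by rewrite /h /g1 /= [in X in _ * X * _]patchE inI (negbTE yab) mulr0 mul0r.
rewrite [LHS]Rintegral_mkcond [RHS]Rintegral_mkcond.
transitivity (fine (\int[mu]_x \int[mu]_y h (x, y))%E).
  by congr fine; apply: eq_integral => x _; rewrite E1.
by rewrite E; congr fine; apply: eq_integral => y _; rewrite E2.
Qed.

End AbsolutelyContinuous.

Section ScalarAC.
Context {R : realType}.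
Notation mu := (@lebesgue_measure R).
Notation meas := (@measurable_fun _ _ (measurableTypeR R) R).
#[local] Hint Resolve itv_meas : core.
Implicit Types (a b s t : R) (f g : R -> R).

(** The scalar case of [ac_deriv], to which the matrix case reduces
    entrywise. *)
Definition scalar_ac a b f g :=
  L1 `[a, b] g /\ forall t, t \in `[a, b] -> f t = f a + \int[mu]_(x in `[a, t]) g x.

Lemma scalar_ac_cont a b f g : a <= b -> scalar_ac a b f g -> {within `[a, b], continuous f}.
Proof.
move=> ab [Ig fE].
apply: (@subspace_eq_continuous _ _ _
   (fun t => f a + \int[mu]_(x in `[a, t]) g x)).
  by move=> t tab; rewrite -fE//; rewrite inE in tab.
have ca : {within `[a, b], continuous (fun=> f a)} by exact: cst_continuous.
exact: (within_continuousD ca (cont_prim ab Ig)).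
Qed.

Lemma scalar_ac_meas a b f g : a <= b -> scalar_ac a b f g -> meas `[a, b] f.
Proof. by move=> ab h; exact: (cont_meas (scalar_ac_cont ab h)). Qed.

Lemma scalar_ac_bdd a b f g : a <= b -> scalar_ac a b f g -> bdd `[a, b] f.
Proof. by move=> ab h; exact: (cont_bdd ab (scalar_ac_cont ab h)). Qed.

Lemma scalar_ac_ext a b f g f1 g1 :
  (forall t, t \in `[a, b] -> f t = f1 t) ->
  (forall t, t \in `[a, b] -> g t = g1 t) -> a <= b ->
  scalar_ac a b f g -> scalar_ac a b f1 g1.
Proof.
move=> ff gg ab [Ig fE]; split; first exact: L1_ext Ig.
have aab : a \in `[a, b] by rewrite in_itv /= lexx.
move=> t tab; rewrite -(ff t tab) -(ff a aab) (fE t tab).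
by congr (_ + _); apply: itg_ext => x /= xat; apply: gg; exact: itv_subl xat.
Qed.

Lemma scalar_ac_prim a b g : L1 `[a, b] g -> scalar_ac a b (fun t => \int[mu]_(x in `[a, t]) g x) g.
Proof.
by move=> Ig; split=> // t tab; rewrite set_itv1 Rintegral_set1 add0r.
Qed.

Lemma scalar_ac_cst a b c : scalar_ac a b (fun=> c) (fun=> 0).
Proof. by split=> [|t _]; [exact: L1_0|rewrite itg0// addr0]. Qed.

Lemma scalar_acD a b f g f1 g1 : scalar_ac a b f g -> scalar_ac a b f1 g1 ->
  scalar_ac a b (fun t => f t + f1 t) (fun t => g t + g1 t).
Proof.
move=> [Ig fE] [Ig1 f1E]; split=> [|t tab]; first exact: L1D.
rewrite itgD//; first by rewrite (fE t tab) (f1E t tab) addrACA.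
- exact: (L1_itvl tab).
- exact: (L1_itvl tab).
Qed.

Lemma scalar_acZ a b c f g : scalar_ac a b f g ->
  scalar_ac a b (fun t => c * f t) (fun t => c * g t).
Proof.
move=> [Ig fE]; split=> [|t tab]; first exact: L1Z.
by rewrite itgZ ?(fE t tab) ?mulrDr//; exact: (L1_itvl tab).
Qed.

Lemma scalar_ac_sum a b (I : Type) (r : seq I) (f g : I -> R -> R) :
  (forall i, scalar_ac a b (f i) (g i)) ->
  scalar_ac a b (fun t => \sum_(i <- r) f i t) (fun t => \sum_(i <- r) g i t).
Proof.
move=> h; split=> [|t tab]; first by apply: L1_sum => // i; case: (h i).
rewrite itg_sum//; last by move=> i; apply: (L1_itvl tab); case: (h i).
by rewrite -big_split /=; apply: eq_bigr => i _; case: (h i) => _ ->.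
Qed.

Lemma scalar_ac_incr a b f g s t : scalar_ac a b f g -> s \in `[a, b] -> t \in `[a, b] -> s <= t ->
  f t = f s + \int[mu]_(x in `[s, t]) g x.
Proof.
move=> [Ig fE] sab tab st; rewrite (fE t tab) (fE s sab) -addrA; congr (_ + _).
apply: itg_split; last exact: (L1_itvl tab).
by move: sab; rewrite !in_itv /= st => /andP[->].
Qed.

Lemma L1_sub a b s t f : s \in `[a, b] -> t \in `[a, b] -> L1 `[a, b] f -> L1 `[s, t] f.
Proof.
move=> sab tab; apply: L1S => // x /=; move: sab tab; rewrite !in_itv /=.
move=> /andP[as_ _] /andP[_ tb] /andP[sx xt].
by rewrite (le_trans as_)// (le_trans xt).
Qed.

(** Splitting the square [a, b]^2 along its diagonal. *)
Lemma itg_prod a b f g : a <= b -> L1 `[a, b] f -> L1 `[a, b] g ->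
  (\int[mu]_(t in `[a, b]) f t) * (\int[mu]_(t in `[a, b]) g t) =
  \int[mu]_(t in `[a, b]) (f t * \int[mu]_(x in `[a, t]) g x) +
  \int[mu]_(t in `[a, b]) ((\int[mu]_(x in `[a, t]) f x) * g t).
Proof.
move=> ab If Ig; rewrite itg_triangle//.
set F := fun t => \int[mu]_(x in `[a, t]) f x.
have IFg : L1 `[a, b] (fun t => F t * g t).
  apply: L1_bddM => //; first exact: (cont_meas (cont_prim ab If)).
  exact: (cont_bdd ab (cont_prim ab If)).
rewrite -itgZ//.
have -> : \int[mu]_(t in `[a, b]) (g t * \int[mu]_(x in `[t, b]) f x) =
    \int[mu]_(t in `[a, b]) (F b * g t + (-1) * (F t * g t)).
  apply: itg_ext => t tab.
  by rewrite /F (itg_split tab If); ring.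
rewrite itgD//; [|exact: L1Z|exact: L1Z].
rewrite (@itgZ _ _ _ (-1))// mulN1r subrK.
by apply: itg_ext.
Qed.

Lemma scalar_acM a b f g f1 g1 : a <= b -> scalar_ac a b f g -> scalar_ac a b f1 g1 ->
  scalar_ac a b (fun t => f t * f1 t) (fun t => g t * f1 t + f t * g1 t).
Proof.
move=> ab hf hf1; have [Ig fE] := hf; have [Ig1 f1E] := hf1.
have Igf1 : L1 `[a, b] (fun t => f1 t * g t).
  by apply: L1_bddM => //; [exact: scalar_ac_meas hf1|exact: scalar_ac_bdd hf1].
have Ifg1 : L1 `[a, b] (fun t => f t * g1 t).
  by apply: L1_bddM => //; [exact: scalar_ac_meas hf|exact: scalar_ac_bdd hf].
have Igf1' : L1 `[a, b] (fun t => g t * f1 t).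
  by apply: L1_ext Igf1 => // t _; rewrite mulrC.
split=> [|t tab]; first exact: L1D.
have at_ : a <= t by move: tab; rewrite in_itv /= => /andP[].
have It := L1_itvl tab.
rewrite itgD//; [|exact: It|exact: It].
set F := fun t => \int[mu]_(x in `[a, t]) g x.
set F1 := fun t => \int[mu]_(x in `[a, t]) g1 x.
have sub x : `[a, t]%classic x -> x \in `[a, b] by move=> /(itv_subl tab).
have IgF1 : L1 `[a, t] (fun x => g x * F1 x).
  apply: (@L1_ext _ _ _ (fun x => F1 x * g x)) => //; first by move=> x _; rewrite mulrC.
  apply: (L1_bddM (itv_meas a t)); last exact: It.
    exact: (cont_meas (cont_prim at_ (It _ Ig1))).
  exact: (cont_bdd at_ (cont_prim at_ (It _ Ig1))).
have IFg1 : L1 `[a, t] (fun x => F x * g1 x).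
  apply: (L1_bddM (itv_meas a t)); last exact: It.
    exact: (cont_meas (cont_prim at_ (It _ Ig))).
  exact: (cont_bdd at_ (cont_prim at_ (It _ Ig))).
have -> : \int[mu]_(x in `[a, t]) (g x * f1 x) =
    \int[mu]_(x in `[a, t]) (f1 a * g x + g x * F1 x).
  by apply: itg_ext => x /sub xab; rewrite f1E// /F1; ring.
have -> : \int[mu]_(x in `[a, t]) (f x * g1 x) =
    \int[mu]_(x in `[a, t]) (f a * g1 x + F x * g1 x).
  by apply: itg_ext => x /sub xab; rewrite fE// /F; ring.
rewrite !itgD//; [|exact/L1Z/It|exact/L1Z/It].
rewrite !itgZ//; [|exact/It|exact/It].
have := itg_prod at_ (It _ Ig) (It _ Ig1).
rewrite -/F1 -/F => E.
rewrite (fE t tab) (f1E t tab) addrACA -E; ring.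
Qed.

Lemma scalar_acX a b f g k : a <= b -> scalar_ac a b f g ->
  scalar_ac a b (fun t => f t ^+ k.+1) (fun t => k.+1%:R * (f t ^+ k * g t)).
Proof.
move=> ab h; elim: k => [|k IH].
  by apply: scalar_ac_ext h => // t _; rewrite ?expr1 ?expr0 !mul1r.
apply: scalar_ac_ext (scalar_acM ab h IH) => // t _.
by rewrite -[in RHS](natr1 k.+1) !exprS; ring.
Qed.

(** If |d| <= M on the interval, feeding the bound M |K - K(s)|^k / k! into
    |d'| <= kap |d|, where K is a primitive of kap, improves k to k + 1; the bounds
    tend to 0.  The estimate is needed on both sides of s.  Stated for a finite
    family bounded jointly, it applies to the entries of a matrix. *)
Lemma gronwall_zero a b (I : finType) (d V : I -> R -> R) kap s : a <= b ->
  L1 `[a, b] kap -> (forall t, t \in `[a, b] -> 0 <= kap t) ->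
  (forall i, scalar_ac a b (d i) (V i)) ->
  (forall i t C, t \in `[a, b] -> (forall j, `|d j t| <= C) ->
    `|V i t| <= kap t * C) ->
  s \in `[a, b] -> (forall i, d i s = 0) ->
  forall i t, t \in `[a, b] -> d i t = 0.
Proof.
move=> ab Ik k0 hd dV sab ds0.
pose K t := \int[mu]_(x in `[a, t]) kap x.
have hK : scalar_ac a b K kap by exact: scalar_ac_prim.
have [M HM] : exists M, forall i t, t \in `[a, b] -> `|d i t| <= M.
  have /choice [M HM] : forall i, exists C, forall t, t \in `[a, b] -> `|d i t| <= C.
    by move=> i; have [C HC] := scalar_ac_bdd ab (hd i); exists C.
  exists (\sum_i `|M i|) => i t tab; apply: le_trans (HM i t tab) _.
  rewrite (bigD1 i)//= (le_trans (ler_norm _))// lerDl.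
  exact: sumr_ge0.
have Kmono x y : x \in `[a, b] -> y \in `[a, b] -> x <= y -> K x <= K y.
  move=> xab yab xy; rewrite (scalar_ac_incr hK xab yab xy) lerDl.
  apply: Rintegral_ge0 => z /=; rewrite in_itv /= => /andP[xz zy]; apply: k0.
  move: xab yab; rewrite !in_itv /= => /andP[ax _] /andP[_ yb].
  by rewrite (le_trans ax)// (le_trans zy).
have claim k : forall i t, t \in `[a, b] -> `|d i t| <= M * (`|K t - K s| ^+ k / k`!%:R).
  elim: k => [|k IH] i t tab; first by rewrite expr0 fact0 divr1 mulr1 HM.
  have fk : k.+1%:R / (k.+1)`!%:R = (k`!%:R)^-1 :> R.
    by rewrite factS natrM invfM mulrA divff ?mul1r// pnatr_eq0.
  pose c := M / (k.+1)`!%:R.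
  have [st|/ltW ts] := leP s t.
    have hP : scalar_ac a b (fun t => c * (K t - K s) ^+ k.+1)
        (fun x => c * (k.+1%:R * ((K x - K s) ^+ k * (kap x + 0)))).
      by apply: scalar_acZ; apply: scalar_acX => //; apply: scalar_acD => //; exact: scalar_ac_cst.
    have := scalar_ac_incr hP sab tab st.
    rewrite subrr expr0n /= mulr0 add0r => E.
    rewrite (ger0_norm (x := K t - K s)) ?subr_ge0 ?Kmono//.
    rewrite (_ : M * (_ / _) = c * (K t - K s) ^+ k.+1); last by rewrite /c; ring.
    rewrite E.
    rewrite (scalar_ac_incr (hd i) sab tab st) ds0 add0r.
    apply: norm_itg_le => //.
    - exact: (L1_sub sab tab (proj1 (hd i))).
    - exact: (L1_sub sab tab (proj1 hP)).
    - move=> x /= xst.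
      have xab : x \in `[a, b].
        move: xst sab tab; rewrite !in_itv /= => /andP[sx xt] /andP[ax _] /andP[_ yb].
        by rewrite (le_trans ax)// (le_trans xt).
      have sx : s <= x by move: xst; rewrite in_itv /= => /andP[].
      apply: le_trans (dV i x _ xab (fun j => IH j x xab)) _.
      rewrite ger0_norm ?subr_ge0 ?Kmono// /c -fk addr0 le_eqVlt.
      by apply/orP; left; apply/eqP; ring.
  have hP : scalar_ac a b (fun t => c * (K s - K t) ^+ k.+1)
      (fun x => c * (k.+1%:R * ((K s - K x) ^+ k * (0 + -1 * kap x)))).
    apply: scalar_acZ; apply: scalar_acX => //.
    apply: scalar_ac_ext (scalar_acD (scalar_ac_cst a b (K s)) (scalar_acZ (-1) hK)) => // x _.
    by rewrite mulN1r.
  have := scalar_ac_incr hP tab sab ts.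
  rewrite subrr expr0n /= mulr0 => /esym/eqP; rewrite addr_eq0 => /eqP E.
  rewrite distrC (ger0_norm (x := K s - K t)) ?subr_ge0 ?Kmono//.
  rewrite (_ : M * (_ / _) = c * (K s - K t) ^+ k.+1); last by rewrite /c; ring.
  rewrite E.
  have /eqP := scalar_ac_incr (hd i) tab sab ts.
  rewrite ds0 eq_sym addr_eq0 => /eqP ->; rewrite normrN.
  rewrite -[X in _ <= X]mulN1r -itgZ//; last exact: (L1_sub tab sab (proj1 hP)).
  apply: norm_itg_le => //.
  - exact: (L1_sub tab sab (proj1 (hd i))).
  - exact/L1Z/(L1_sub tab sab (proj1 hP)).
  - move=> x /= xst.
    have xab : x \in `[a, b].
      move: xst sab tab; rewrite !in_itv /= => /andP[sx xt] /andP[_ yb] /andP[ax _].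
      by rewrite (le_trans ax)// (le_trans xt).
    have sx : x <= s by move: xst; rewrite in_itv /= => /andP[].
    apply: le_trans (dV i x _ xab (fun j => IH j x xab)) _.
    rewrite distrC ger0_norm ?subr_ge0 ?Kmono// /c -fk le_eqVlt.
    by apply/orP; left; apply/eqP; ring.
move=> i t tab; apply/eqP; rewrite -normr_le0.
have cv : M * (`|K t - K s| ^+ k / k`!%:R) @[k --> \oo] --> (0 : R).
  rewrite -(mulr0 M); apply: cvgMl_tmp.
  have := cvg_series_cvg_0 (is_cvg_series_exp_coeff `|K t - K s|).
  exact.
rewrite -(cvg_lim _ cv)//.
apply: limr_ge; first by apply/cvg_ex; exists 0.
by apply: nearW => k; exact: claim.
Qed.

End ScalarAC.

(** * Matrix-valued functions *)

Section MatrixClasses.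
Context {R : realType}.
Notation mu := (@lebesgue_measure R).
Notation meas := (@measurable_fun _ _ (measurableTypeR R) R).
#[local] Hint Resolve itv_meas : core.
Implicit Types (C : set (R -> R)).

(** Working entrywise makes closure under matrix products a consequence of closure
    of the scalar classes under products and finite sums. *)
Definition mxall C m n (A : R -> 'M[R]_(m, n)) := forall i j, C (fun t => A t i j).

Definition sum_closed C := forall (I : Type) (s : seq I) (F : I -> R -> R),
  (forall i, C (F i)) -> C (fun t => \sum_(i <- s) F i t).

Lemma mxall_mul C C1 C2 m n p (A : R -> 'M[R]_(m, n)) (B : R -> 'M[R]_(n, p)) :
  (forall f g, C1 f -> C2 g -> C (fun t => f t * g t)) -> sum_closed C ->
  mxall C1 A -> mxall C2 B -> mxall C (fun t => A t *m B t).
Proof.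
move=> CM CS hA hB i j; under eq_fun do rewrite mxE.
by apply: CS => k; apply: CM.
Qed.

Lemma mxall_add C m n (A B : R -> 'M[R]_(m, n)) :
  (forall f g, C f -> C g -> C (fun t => f t + g t)) ->
  mxall C A -> mxall C B -> mxall C (fun t => A t + B t).
Proof. by move=> CD hA hB i j; under eq_fun do rewrite mxE; exact: CD. Qed.

Lemma mxall_scale C c m n (A : R -> 'M[R]_(m, n)) :
  (forall f, C f -> C (fun t => c * f t)) ->
  mxall C A -> mxall C (fun t => c *: A t).
Proof. by move=> CZ hA i j; under eq_fun do rewrite mxE; exact: CZ. Qed.

Lemma mxall_tr C m n (A : R -> 'M[R]_(m, n)) :
  mxall C A -> mxall C (fun t => (A t)^T).
Proof. by move=> hA i j; under eq_fun do rewrite mxE; exact: hA. Qed.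

Variables (a b : R).
Notation D := (`[a, b]%classic : set R).
Let mD : @measurable _ (measurableTypeR R) D := itv_meas a b.

(** The multipliers of both L^1 and L^2 that occur here. *)
Definition mbdd (f : R -> R) := meas D f /\ bdd D f.

Lemma mbddM f g : mbdd f -> mbdd g -> mbdd (fun t => f t * g t).
Proof. by move=> [mf bf] [mg bg]; split; [exact: measurable_funM|exact: bddM]. Qed.

Lemma mbdd_sum : sum_closed mbdd.
Proof.
move=> I s F h; split; last by apply: bdd_sum => i; case: (h i).
by apply: measurable_sum => i; case: (h i).
Qed.

Lemma mbdd_cst c : mbdd (fun=> c).
Proof. by split; [exact: measurable_cst|exists `|c|]. Qed.

Lemma L1_sum_closed : sum_closed (L1 D).
Proof. by move=> I s F h; exact: L1_sum. Qed.

Lemma L2_sum_closed : sum_closed (L2 D).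
Proof. by move=> I s F h; exact: L2_sum. Qed.

Lemma L1_mbdd f g : mbdd f -> L1 D g -> L1 D (fun t => f t * g t).
Proof. by move=> [mf bf]; exact: L1_bddM. Qed.

Lemma L1_mbddr f g : L1 D f -> mbdd g -> L1 D (fun t => f t * g t).
Proof.
by move=> If hg; apply: (L1_ext mD _ (L1_mbdd hg If)) => t _; rewrite mulrC.
Qed.

Lemma L2_mbdd f g : mbdd f -> L2 D g -> L2 D (fun t => f t * g t).
Proof. by move=> [mf bf]; exact: L2_bddM. Qed.

Lemma L2_mbddr f g : L2 D f -> mbdd g -> L2 D (fun t => f t * g t).
Proof.
by move=> If hg; apply: (L2_ext mD _ (L2_mbdd hg If)) => t _; rewrite mulrC.
Qed.

Lemma Lmx1_mull m n p (A : R -> 'M[R]_(m, n)) (B : R -> 'M[R]_(n, p)) :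
  mxall mbdd A -> Lmx 1 a b B -> Lmx 1 a b (fun t => A t *m B t).
Proof.
move=> hA /Lmx1P hB; apply/Lmx1P.
exact: mxall_mul (@L1_mbdd) L1_sum_closed hA hB.
Qed.

Lemma Lmx1_mulr m n p (A : R -> 'M[R]_(m, n)) (B : R -> 'M[R]_(n, p)) :
  Lmx 1 a b A -> mxall mbdd B -> Lmx 1 a b (fun t => A t *m B t).
Proof.
move=> /Lmx1P hA hB; apply/Lmx1P.
exact: mxall_mul (@L1_mbddr) L1_sum_closed hA hB.
Qed.

Lemma Lmx2_mulr m n p (A : R -> 'M[R]_(m, n)) (B : R -> 'M[R]_(n, p)) :
  Lmx 2%:E a b A -> mxall mbdd B -> Lmx 2%:E a b (fun t => A t *m B t).
Proof.
move=> /Lmx2P hA hB; apply/Lmx2P.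
exact: mxall_mul (@L2_mbddr) L2_sum_closed hA hB.
Qed.

Lemma Lmx2_mul_Lmx1 m n p (A : R -> 'M[R]_(m, n)) (B : R -> 'M[R]_(n, p)) :
  Lmx 2%:E a b A -> Lmx 2%:E a b B -> Lmx 1 a b (fun t => A t *m B t).
Proof.
move=> /Lmx2P hA /Lmx2P hB; apply/Lmx1P.
exact: (mxall_mul (fun f g => @L1_L2M _ _ mD f g) L1_sum_closed hA hB).
Qed.

Lemma mbdd_mul m n p (A : R -> 'M[R]_(m, n)) (B : R -> 'M[R]_(n, p)) :
  mxall mbdd A -> mxall mbdd B -> mxall mbdd (fun t => A t *m B t).
Proof. exact: mxall_mul mbddM mbdd_sum. Qed.

Lemma mbdd_mxcst m n (A : 'M[R]_(m, n)) : mxall mbdd (fun=> A).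
Proof. by move=> i j; exact: mbdd_cst. Qed.

Lemma Lmx1_add m n (A B : R -> 'M[R]_(m, n)) :
  Lmx 1 a b A -> Lmx 1 a b B -> Lmx 1 a b (fun t => A t + B t).
Proof.
move=> /Lmx1P hA /Lmx1P hB; apply/Lmx1P.
exact: (mxall_add (fun f g => @L1D _ _ mD f g) hA hB).
Qed.

Lemma Lmx2_add m n (A B : R -> 'M[R]_(m, n)) :
  Lmx 2%:E a b A -> Lmx 2%:E a b B -> Lmx 2%:E a b (fun t => A t + B t).
Proof.
move=> /Lmx2P hA /Lmx2P hB; apply/Lmx2P.
exact: (mxall_add (fun f g => @L2D _ _ mD f g) hA hB).
Qed.

Lemma Lmx1_scale c m n (A : R -> 'M[R]_(m, n)) :
  Lmx 1 a b A -> Lmx 1 a b (fun t => c *: A t).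
Proof.
move=> /Lmx1P hA; apply/Lmx1P.
exact: (mxall_scale (fun f => @L1Z _ _ mD c f) hA).
Qed.

Lemma Lmx2_scale c m n (A : R -> 'M[R]_(m, n)) :
  Lmx 2%:E a b A -> Lmx 2%:E a b (fun t => c *: A t).
Proof.
move=> /Lmx2P hA; apply/Lmx2P.
exact: (mxall_scale (fun f => @L2Z _ _ mD c f) hA).
Qed.

Lemma Lmx1_opp m n (A : R -> 'M[R]_(m, n)) :
  Lmx 1 a b A -> Lmx 1 a b (fun t => - A t).
Proof.
by move=> hA; under eq_fun do rewrite -scaleN1r; exact: Lmx1_scale.
Qed.

Lemma Lmx2_opp m n (A : R -> 'M[R]_(m, n)) :
  Lmx 2%:E a b A -> Lmx 2%:E a b (fun t => - A t).
Proof.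
by move=> hA; under eq_fun do rewrite -scaleN1r; exact: Lmx2_scale.
Qed.

Lemma Lmx1_tr m n (A : R -> 'M[R]_(m, n)) :
  Lmx 1 a b A -> Lmx 1 a b (fun t => (A t)^T).
Proof. by move=> /Lmx1P hA; apply/Lmx1P; exact: (@mxall_tr (L1 D) _ _ _ hA). Qed.

Lemma Lmx2_tr m n (A : R -> 'M[R]_(m, n)) :
  Lmx 2%:E a b A -> Lmx 2%:E a b (fun t => (A t)^T).
Proof. by move=> /Lmx2P hA; apply/Lmx2P; exact: (@mxall_tr (L2 D) _ _ _ hA). Qed.

Lemma Lmx1_ext m n (A B : R -> 'M[R]_(m, n)) :
  (forall t, t \in `[a, b] -> A t = B t) -> Lmx 1 a b A -> Lmx 1 a b B.
Proof.
move=> AB /Lmx1P hA; apply/Lmx1P => i j.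
by apply: (L1_ext mD _ (hA i j)) => t tab; rewrite AB.
Qed.

Definition wcont (f : R -> R) := {within D, continuous f}.

Lemma wcontM f g : wcont f -> wcont g -> wcont (fun t => f t * g t).
Proof. by move=> cf cg x; exact: (continuousM (cf x) (cg x)). Qed.

Lemma wcont_cst c : wcont (fun=> c).
Proof. exact: cst_continuous. Qed.

Lemma wcontD f g : wcont f -> wcont g -> wcont (fun t => f t + g t).
Proof. exact: within_continuousD. Qed.

Lemma wcont_sum : sum_closed wcont.
Proof.
move=> I s F h; elim: s => [|i s IH].
  by under eq_fun do rewrite big_nil; exact: wcont_cst.
by under eq_fun do rewrite big_cons; apply: wcontD; [exact: h|exact: IH].
Qed.

Lemma wcont_prod (I : Type) (s : seq I) (F : I -> R -> R) :
  (forall i, wcont (F i)) -> wcont (fun t => \prod_(i <- s) F i t).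
Proof.
move=> h; elim: s => [|i s IH].
  by under eq_fun do rewrite big_nil; exact: wcont_cst.
by under eq_fun do rewrite big_cons; apply: wcontM; [exact: h|exact: IH].
Qed.

Lemma wcont_det n (X : R -> 'M[R]_n) : mxall wcont X -> wcont (fun t => \det (X t)).
Proof.
move=> hX; apply: wcont_sum => s; apply: wcontM; first exact: wcont_cst.
by apply: wcont_prod => i; exact: hX.
Qed.

Lemma wcont_adj n (X : R -> 'M[R]_n) : mxall wcont X -> mxall wcont (fun t => \adj (X t)).
Proof.
move=> hX i j; under eq_fun do rewrite mxE.
apply: wcontM; first exact: wcont_cst.
by apply: wcont_det => k l; under eq_fun do rewrite !mxE; exact: hX.
Qed.

Lemma mbdd_wcont f : a <= b -> wcont f -> mbdd f.
Proof. by move=> ab cf; split; [exact: cont_meas|exact: cont_bdd]. Qed.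

Lemma mbdd_ext f g : (forall t, t \in `[a, b] -> f t = g t) -> mbdd f -> mbdd g.
Proof.
move=> fg [mf [C fC]]; split; last by exists C => t tab; rewrite -fg// fC.
by apply: eq_measurable_fun mf => t; rewrite inE => /fg.
Qed.

(** By Cramer's rule the inverse is a continuous function of the parameter, and
    the interval is compact. *)
Lemma mbdd_invmx n (X : R -> 'M[R]_n) : a <= b -> mxall wcont X ->
  (forall t, t \in `[a, b] -> X t \in unitmx) -> mxall mbdd (fun t => invmx (X t)).
Proof.
move=> ab hX Xu i j.
apply: (@mbdd_ext (fun t => (\det (X t))^-1 * (\adj (X t)) i j)).
  by move=> t tab; rewrite /invmx (Xu t tab) [RHS]mxE.
apply: mbdd_wcont => //; apply: wcontM; last exact: wcont_adj.
have := @within_continuous_comp _ _ _ D (fun t => \det (X t)) (@GRing.inv R).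
apply; last exact: wcont_det.
move=> _ /set_mem [t tab <-]; apply: inv_continuous.
by have := Xu t tab; rewrite unitmxE unitfE.
Qed.

End MatrixClasses.

Section MatrixAC.
Context {R : realType}.
Notation mu := (@lebesgue_measure R).
#[local] Hint Resolve itv_meas : core.
Variables (a b : R).
Hypothesis ab : a <= b.

Lemma ac_derivP m n (X V : R -> 'M[R]_(m, n)) :
  ac_deriv a b X V <-> forall i j, scalar_ac a b (fun t => X t i j) (fun t => V t i j).
Proof.
split=> [[/Lmx1P hV hX] i j|h].
  by split=> [|t tab]; [exact: hV|rewrite {1}hX// !mxE].
split; first by apply/Lmx1P => i j; case: (h i j).
by move=> t tab; apply/matrixP => i j; rewrite !mxE; case: (h i j) => _ ->.
Qed.

Lemma ac_wcont m n (X V : R -> 'M[R]_(m, n)) :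
  ac_deriv a b X V -> mxall (wcont a b) X.
Proof. by move=> /ac_derivP h i j; exact: (scalar_ac_cont ab (h i j)). Qed.

Lemma ac_mbdd m n (X V : R -> 'M[R]_(m, n)) :
  ac_deriv a b X V -> mxall (mbdd a b) X.
Proof. by move=> h i j; apply: mbdd_wcont => //; exact: (ac_wcont h). Qed.

Lemma ac_mul m n p (X V : R -> 'M[R]_(m, n)) (Y Z : R -> 'M[R]_(n, p)) :
  ac_deriv a b X V -> ac_deriv a b Y Z ->
  ac_deriv a b (fun t => X t *m Y t) (fun t => V t *m Y t + X t *m Z t).
Proof.
move=> /ac_derivP hX /ac_derivP hY; apply/ac_derivP => i j.
under eq_fun do rewrite mxE.
under [X in scalar_ac _ _ _ X]eq_fun do rewrite !mxE -big_split /=.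
by apply: scalar_ac_sum => k; exact: scalar_acM.
Qed.

Lemma ac_add m n (X V Y Z : R -> 'M[R]_(m, n)) :
  ac_deriv a b X V -> ac_deriv a b Y Z ->
  ac_deriv a b (fun t => X t + Y t) (fun t => V t + Z t).
Proof.
move=> /ac_derivP hX /ac_derivP hY; apply/ac_derivP => i j.
under eq_fun do rewrite mxE.
by under [X in scalar_ac _ _ _ X]eq_fun do rewrite mxE; exact: scalar_acD.
Qed.

Lemma ac_opp m n (X V : R -> 'M[R]_(m, n)) :
  ac_deriv a b X V -> ac_deriv a b (fun t => - X t) (fun t => - V t).
Proof.
move=> /ac_derivP hX; apply/ac_derivP => i j.
under eq_fun do rewrite mxE -mulN1r.
by under [X in scalar_ac _ _ _ X]eq_fun do rewrite mxE -mulN1r; exact: scalar_acZ.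
Qed.

Lemma ac_cst m n (A : 'M[R]_(m, n)) : ac_deriv a b (fun=> A) (fun=> 0).
Proof.
apply/ac_derivP => i j; under [X in scalar_ac _ _ _ X]eq_fun do rewrite mxE.
exact: scalar_ac_cst.
Qed.

Lemma ac_tr m n (X V : R -> 'M[R]_(m, n)) :
  ac_deriv a b X V -> ac_deriv a b (fun t => (X t)^T) (fun t => (V t)^T).
Proof.
move=> /ac_derivP hX; apply/ac_derivP => i j.
under eq_fun do rewrite mxE.
by under [X in scalar_ac _ _ _ X]eq_fun do rewrite mxE; exact: hX.
Qed.

Lemma ac_ext m n (X V Y Z : R -> 'M[R]_(m, n)) :
  (forall t, t \in `[a, b] -> X t = Y t) ->
  (forall t, t \in `[a, b] -> V t = Z t) ->
  ac_deriv a b X V -> ac_deriv a b Y Z.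
Proof.
move=> XY VZ /ac_derivP h; apply/ac_derivP => i j.
by apply: scalar_ac_ext (h i j) => // t tab; rewrite ?XY ?VZ.
Qed.

(** The integrability of Z is assumed because Borel measurability is not inherited
    from an almost everywhere equal function. *)
Lemma ac_ae m n (X V Z : R -> 'M[R]_(m, n)) :
  Lmx 1 a b Z -> {ae mu, forall t, t \in `[a, b] -> V t = Z t} ->
  ac_deriv a b X V -> ac_deriv a b X Z.
Proof.
move=> hZ VZ [hV hX]; split=> // t tab; rewrite hX//; congr (_ + _).
apply/matrixP => i j; rewrite !mxE; apply: itg_ae => //.
- exact: (L1_itvl tab (proj1 (Lmx1P _ _ _) hV i j)).
- exact: (L1_itvl tab (proj1 (Lmx1P _ _ _) hZ i j)).
- have mu_ae : Filter (almost_everywhere mu) by exact: (ae_filter_ringOfSetsType mu).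
  apply: (@filterS _ _ mu_ae _ _ _ VZ) => s VZs sat.
  by rewrite VZs//; exact: (itv_subl tab).
Qed.

Lemma ac_prim m n (V : R -> 'M[R]_(m, n)) :
  Lmx 1 a b V -> ac_deriv a b (fun t => mxint a t V) V.
Proof.
move=> /Lmx1P hV; apply/ac_derivP => i j.
by under eq_fun do rewrite mxE; exact: scalar_ac_prim.
Qed.

Lemma mxint_aa m n (V : R -> 'M[R]_(m, n)) : mxint a a V = 0.
Proof. by apply/matrixP => i j; rewrite !mxE set_itv1 Rintegral_set1. Qed.

Lemma ac_mulcl m n p (C : 'M[R]_(m, n)) (X V : R -> 'M[R]_(n, p)) :
  ac_deriv a b X V -> ac_deriv a b (fun t => C *m X t) (fun t => C *m V t).
Proof.
move=> h; apply: ac_ext (ac_mul (ac_cst C) h) => // t _.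
by rewrite mul0mx add0r.
Qed.

Lemma ac_mulcr m n p (C : 'M[R]_(n, p)) (X V : R -> 'M[R]_(m, n)) :
  ac_deriv a b X V -> ac_deriv a b (fun t => X t *m C) (fun t => V t *m C).
Proof.
move=> h; apply: ac_ext (ac_mul h (ac_cst C)) => // t _.
by rewrite mulmx0 addr0.
Qed.

Lemma lin_ode_unique n k (A : R -> 'M[R]_n) (X : R -> 'M[R]_(n, k)) s :
  Lmx 1 a b A -> ac_deriv a b X (fun t => A t *m X t) ->
  s \in `[a, b] -> X s = 0 -> forall t, t \in `[a, b] -> X t = 0.
Proof.
move=> /Lmx1P hA /ac_derivP hX sab Xs0 t tab.
apply/matrixP => i j; rewrite mxE.
pose kap t := \sum_i \sum_l `|A t i l|.
apply: (@gronwall_zero R a b ('I_n * 'I_k)%type (fun ij t => X t ij.1 ij.2)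
   (fun ij t => (A t *m X t) ij.1 ij.2) kap s ab _ _ _ _ sab _ (i, j) t tab).
- by apply: L1_sum => // p; apply: L1_sum => // q; exact: L1_norm.
- by move=> u _; apply: sumr_ge0 => p _; apply: sumr_ge0.
- by case=> p q; exact: hX.
- move=> [p q] u C uab XC /=; have C0 : 0 <= C by apply: le_trans (XC (p, q)).
  rewrite mxE; apply: le_trans (ler_norm_sum _ _ _) _.
  apply: (@le_trans _ _ (\sum_l `|A u p l| * C)).
    by apply: ler_sum => l _; rewrite normrM ler_wpM2l//; exact: (XC (l, q)).
  rewrite -mulr_suml ler_wpM2r// /kap [leRHS](bigD1 p)//= lerDl.
  by apply: sumr_ge0 => r _; apply: sumr_ge0.
- by case=> p q; rewrite Xs0 mxE.
Qed.

Lemma lin_ode_eq n k (A : R -> 'M[R]_n) (q X Y : R -> 'M[R]_(n, k)) s :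
  Lmx 1 a b A ->
  ac_deriv a b X (fun t => A t *m X t + q t) ->
  ac_deriv a b Y (fun t => A t *m Y t + q t) ->
  s \in `[a, b] -> X s = Y s -> forall t, t \in `[a, b] -> X t = Y t.
Proof.
move=> hA hX hY sab XYs t tab; apply/eqP; rewrite -subr_eq0; apply/eqP.
apply: (lin_ode_unique (X := fun t => X t - Y t) hA _ sab _ tab).
  apply: ac_ext (ac_add hX (ac_opp hY)) => // u _.
  by rewrite opprD addrACA subrr addr0 mulmxBr.
by rewrite XYs subrr.
Qed.

End MatrixAC.

Section IntegralExtras.
Context {R : realType}.
Notation mu := (@lebesgue_measure R).
#[local] Hint Resolve itv_meas : core.

Lemma ac_scale (a b c : R) m n (X V : R -> 'M[R]_(m, n)) : a <= b ->
  ac_deriv a b X V -> ac_deriv a b (fun t => c *: X t) (fun t => c *: V t).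
Proof.
move=> ab h; apply: (ac_ext ab _ _ (ac_mulcl ab c%:M h)) => t _;
  by rewrite mul_scalar_mx.
Qed.

(** The product rule against a constant matrix, read at t. *)
Lemma mxint_mull (a b t : R) m n p (C : 'M[R]_(m, n)) (V : R -> 'M[R]_(n, p)) :
  a <= b -> t \in `[a, b] -> Lmx 1 a b V ->
  C *m mxint a t V = mxint a t (fun s => C *m V s).
Proof.
move=> ab tab hV; have [_ /(_ t tab)] := ac_mulcl ab C (ac_prim hV).
by rewrite mxint_aa mulmx0 add0r.
Qed.

Lemma mxint_mulr (a b t : R) m n p (C : 'M[R]_(n, p)) (V : R -> 'M[R]_(m, n)) :
  a <= b -> t \in `[a, b] -> Lmx 1 a b V ->
  mxint a t V *m C = mxint a t (fun s => V s *m C).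
Proof.
move=> ab tab hV; have [_ /(_ t tab)] := ac_mulcr ab C (ac_prim hV).
by rewrite mxint_aa mul0mx add0r.
Qed.

Lemma itg_cut (a s t : R) (f : R -> R) :
  \int[mu]_(x in `[a, s]) (\1_`[a, t] x * f x) =
  \int[mu]_(x in `[a, Num.min s t]) f x.
Proof.
have -> : `[a, Num.min s t]%classic = `[a, s]%classic `&` `[a, t]%classic.
  apply/seteqP; split=> x /=; rewrite !in_itv /= le_min.
    by move=> /andP[-> /andP[-> ->]].
  by move=> [/andP[-> ->] /andP[_ ->]].
rewrite Rintegral_mkcondr; apply: itg_ext => // x _.
by rewrite patchE indicE; case: (_ \in _); rewrite ?mul1r ?mul0r.
Qed.

Lemma mxint_cut (a s t : R) m n (V : R -> 'M[R]_(m, n)) :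
  mxint a s (fun x => \1_`[a, t] x *: V x) = mxint a (Num.min s t) V.
Proof.
apply/matrixP => i j; rewrite !mxE -itg_cut; apply: itg_ext => // x _.
by rewrite mxE.
Qed.

Lemma mbdd_indic (a b : R) (E : set R) : @measurable _ (measurableTypeR R) E ->
  mbdd a b (\1_E).
Proof.
move=> mE; split; first exact: measurable_indic.
by exists 1 => t _; rewrite indicE; case: (_ \in _); rewrite ?normr1 ?normr0.
Qed.

Lemma Lmx2_mask (a b : R) (E : set R) m n (V : R -> 'M[R]_(m, n)) :
  @measurable _ (measurableTypeR R) E ->
  Lmx 2%:E a b V -> Lmx 2%:E a b (fun t => \1_E t *: V t).
Proof.
move=> mE /Lmx2P hV; apply/Lmx2P => i j.
apply: (L2_ext (itv_meas a b) _ (L2_mbdd (mbdd_indic a b mE) (hV i j))) => t _.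
by rewrite mxE.
Qed.

End IntegralExtras.

Section MeasurableRoot.
Context {R : realType}.
Notation mu := (@lebesgue_measure R).
Notation meas := (@measurable_fun _ _ (measurableTypeR R) R).
Variable (D : set R).
Hypothesis mD : @measurable _ (measurableTypeR R) D.

Lemma meas_sum_closed : sum_closed (meas D).
Proof. by move=> I s F h; exact: measurable_sum. Qed.

Lemma meas_mul m n p (A : R -> 'M[R]_(m, n)) (B : R -> 'M[R]_(n, p)) :
  mxall (meas D) A -> mxall (meas D) B -> mxall (meas D) (fun t => A t *m B t).
Proof.
apply: mxall_mul meas_sum_closed => f g; exact: measurable_funM.
Qed.

Lemma meas_scale m n (f : R -> R) (A : R -> 'M[R]_(m, n)) :
  meas D f -> mxall (meas D) A -> mxall (meas D) (fun t => f t *: A t).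
Proof.
by move=> mf mA i j; under eq_fun do rewrite mxE; exact: measurable_funM.
Qed.

Lemma meas_add m n (A B : R -> 'M[R]_(m, n)) :
  mxall (meas D) A -> mxall (meas D) B -> mxall (meas D) (fun t => A t + B t).
Proof. by apply: mxall_add => f g; exact: measurable_funD. Qed.

Lemma meas_mxcst m n (A : 'M[R]_(m, n)) : mxall (meas D) (fun=> A).
Proof. by move=> i j; exact: measurable_cst. Qed.

Lemma meas_one_minus n (A : R -> 'M[R]_n) :
  mxall (meas D) A -> mxall (meas D) (fun t => 1%:M - A t).
Proof.
move=> mA; apply: meas_add; first exact: meas_mxcst.
move=> i j; under eq_fun do rewrite mxE.
exact: measurable_funN.
Qed.

(** The root is the limit of iterates whose entries are, up to a scalar factor,
    polynomials in the entries of Q. *)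
Lemma psd_sqrt_meas n (Q : R -> 'M[R]_n) : mxall (meas D) Q ->
  (forall t, D t -> is_psd (Q t)) -> mxall (meas D) (fun t => psd_sqrt (Q t)).
Proof.
move=> mQ Qp.
have mc : meas D (fun t => sqrt_scale (Q t)).
  apply: measurable_funD; first exact: measurable_cst.
  apply: measurable_sum => i; apply: measurable_sum => j.
  exact: (measurableT_comp _ (mQ i j)).
have mcV : meas D (fun t => (sqrt_scale (Q t))^-1).
  rewrite (_ : (fun t => _) = (@powR R ^~ (-1)) \o (fun t => sqrt_scale (Q t))).
    exact: (measurableT_comp (measurable_powR _)).
  by apply/funext => t /=; rewrite powR_inv1// ltW// sqrt_scale_gt0.
have mcS : meas D (fun t => Num.sqrt (sqrt_scale (Q t))).
  rewrite (_ : (fun t => _) = (@powR R ^~ 2^-1) \o (fun t => sqrt_scale (Q t))).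
    exact: (measurableT_comp (measurable_powR _)).
  by apply/funext => t /=; rewrite powR12_sqrt// ltW// sqrt_scale_gt0.
have mB : mxall (meas D) (fun t => sqrt_arg (Q t)).
  by apply: meas_one_minus; exact: meas_scale.
have mY k : mxall (meas D) (fun t => sqrt_iter (sqrt_arg (Q t)) k).
  elim: k => [|k IH] /=; first exact: meas_mxcst.
  apply: meas_scale; first exact: measurable_cst.
  by apply: meas_add => //; exact: meas_mul.
move=> i j.
apply: (@measurable_fun_cvg _ _ _ D (fun k t => sqrt_approx (Q t) k i j)).
  by move=> k; apply: meas_scale => //; exact: meas_one_minus.
by move=> t Dt; have [_ _] := psd_sqrtP (Qp t Dt); apply.
Qed.

End MeasurableRoot.

(** * Linear differential equations *)

Section TransitionMatrix.
Context {R : realType}.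
Notation mu := (@lebesgue_measure R).
Variables (a b : R) (n : nat) (A : R -> 'M[R]_n) (Phi : R -> R -> 'M[R]_n).
Hypotheses (ab : a <= b) (A_L1 : Lmx 1 a b A)
  (Phi_ac : forall t, t \in `[a, b] ->
     ac_deriv a b (Phi^~ t) (fun tau => A tau *m Phi tau t) /\ Phi t t = 1%:M).

Let aab : a \in `[a, b]. Proof. by rewrite in_itv /= lexx. Qed.

(** Both sides solve the same linear equation in t and agree at t = s; for t < s
    this uses uniqueness backward in time. *)
Lemma transition_cocycle s t : s \in `[a, b] -> t \in `[a, b] ->
  Phi t s *m Phi s a = Phi t a.
Proof.
move=> sab tab; have [h1 Pss] := Phi_ac sab; have [h2 _] := Phi_ac aab.
apply: (@lin_ode_eq _ _ _ ab _ _ A (fun=> 0) (fun t => Phi t s *m Phi s a) (Phi^~ a) s) => //.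
- by apply: ac_ext (ac_mulcr ab (Phi s a) h1) => // u _; rewrite addr0 mulmxA.
- by apply: ac_ext h2 => // u _; rewrite addr0.
- by rewrite Pss mul1mx.
Qed.

Lemma transition_unit s : s \in `[a, b] -> Phi s a \in unitmx.
Proof.
move=> sab; have := transition_cocycle sab aab.
by rewrite (proj2 (Phi_ac aab)) => /mulmx1_unit [].
Qed.

Lemma transitionE s t : s \in `[a, b] -> t \in `[a, b] ->
  Phi t s = Phi t a *m invmx (Phi s a).
Proof. by move=> sab tab; rewrite -(transition_cocycle sab tab) mulmxK// transition_unit. Qed.

Lemma transition_inv_mbdd : mxall (mbdd a b) (fun s => invmx (Phi s a)).
Proof.
apply: mbdd_invmx => //; first exact: ac_wcont (proj1 (Phi_ac aab)).
exact: transition_unit.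
Qed.

(** The variation of constants formula, with Phi(t, s) written as
    Phi(t, a) Phi(s, a)^-1 so that only one column of Phi occurs. *)
Definition duhamel k (x0 : 'M[R]_(n, k)) (q : R -> 'M[R]_(n, k)) t :=
  Phi t a *m (x0 + mxint a t (fun s => invmx (Phi s a) *m q s)).

Lemma duhamel_init k (x0 : 'M[R]_(n, k)) q : duhamel x0 q a = x0.
Proof. by rewrite /duhamel mxint_aa addr0 (proj2 (Phi_ac aab)) mul1mx. Qed.

Lemma duhamel_ac k (x0 : 'M[R]_(n, k)) q : Lmx 1 a b q ->
  ac_deriv a b (duhamel x0 q) (fun t => A t *m duhamel x0 q t + q t).
Proof.
move=> hq; have [hP _] := Phi_ac aab.
have hI := ac_prim (Lmx1_mull transition_inv_mbdd hq).
apply: ac_ext (ac_mul ab hP (ac_add (ac_cst a b x0) hI)) => // t tab.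
by rewrite add0r mulmxA mulmxV ?mul1mx ?transition_unit// -mulmxA.
Qed.

Lemma duhamel_unique k (x0 : 'M[R]_(n, k)) q x : Lmx 1 a b q ->
  ac_deriv a b x (fun t => A t *m x t + q t) -> x a = x0 ->
  forall t, t \in `[a, b] -> x t = duhamel x0 q t.
Proof.
move=> hq hx xa; apply: (lin_ode_eq ab A_L1 hx (duhamel_ac x0 hq) aab).
by rewrite duhamel_init.
Qed.

End TransitionMatrix.

(** * Completeness of L^2 *)

Section RieszFischer.
Context {R : realType}.
Notation mu := (@lebesgue_measure R).
Notation meas := (@measurable_fun _ _ (measurableTypeR R) R).
Context (D : set R) (mD : @measurable _ (measurableTypeR R) D).
Hypothesis D_fin : (mu D < +oo)%E.

Lemma L1_cst c : L1 D (fun=> c).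
Proof.
by apply: measurable_bounded_integrable => //; exact: bounded_cst.
Qed.

Lemma L2_sub f g : L2 D f -> L2 D g -> L2 D (fun t => f t - g t).
Proof.
move=> Lf Lg.
by apply: (L2_ext mD _ (L2D mD Lf (L2Z mD (-1) Lg))) => t _; rewrite mulN1r.
Qed.

(** Integrate 2 |h| <= e + h^2 / e for h = f - g, with e itself bounding the L^2 norm
    of h. *)
Lemma L2_dist_L1 f g (e : R) : 0 < e -> L2 D f -> L2 D g ->
  \int[mu]_(t in D) (f t - g t) ^+ 2 < e ^+ 2 ->
  \int[mu]_(t in D) `|f t - g t| <= e * ((fine (mu D) + 1) / 2).
Proof.
move=> e0 Lf Lg h; have [mfg Ifg] := L2_sub Lf Lg.
have Ib : L1 D (fun t => 2^-1 * (e + e^-1 * (f t - g t) ^+ 2)).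
  by apply: L1Z => //; apply: L1D => //; [exact: L1_cst|exact: L1Z].
have amgm (y : R) : `|y| <= 2^-1 * (e + e^-1 * y ^+ 2).
  rewrite -(real_normK (num_real y)); move: `|y| => x.
  have -> : 2^-1 * (e + e^-1 * x ^+ 2) = x + (2 * e)^-1 * (x - e) ^+ 2.
    by field; rewrite gt_eqF.
  by rewrite lerDl mulr_ge0 ?sqr_ge0// invr_ge0 mulr_ge0// ltW.
have Ia : L1 D (fun t => `|f t - g t|).
  apply: (L1_le mD _ Ib) => [|t _]; first exact: measurableT_comp.
  by rewrite normr_id.
apply: (@le_trans _ _ (\int[mu]_(t in D) (2^-1 * (e + e^-1 * (f t - g t) ^+ 2)))).
  by apply: le_itg.
rewrite itgZ//; last by apply: L1D => //; [exact: L1_cst|exact: L1Z].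
rewrite itgD//; [|exact: L1_cst|exact: L1Z].
rewrite itgZ// Rintegral_cst// mulrA [2^-1 * _]mulrC ler_wpM2r ?invr_ge0//.
rewrite mulrDr mulr1 lerD2l.
by rewrite mulrC ler_pdivrMr// -expr2 ltW.
Qed.

(** The series of the increments has finite integral, hence converges absolutely
    almost everywhere. *)
Lemma ae_cvg_of_summable_steps (g : nat -> R -> R) (c : R) : 0 <= c ->
  (forall k, L2 D (g k)) ->
  (forall k, \int[mu]_(t in D) `|g k.+1 t - g k t| <= c * 2^-1 ^+ k) ->
  {ae mu, forall t, D t -> cvgn (fun k => g k t)}.
Proof.
move=> c0 Lg hg.
pose d k t := `|g k.+1 t - g k t|.
have md k : meas D (d k).
  by apply: measurableT_comp => //; case: (L2_sub (Lg k.+1) (Lg k)).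
have Id k : L1 D (d k).
  have Lk := L2_sub (Lg k.+1) (Lg k).
  apply: (L1_le mD (md k) (L1D mD (L1_cst 1) (proj2 Lk))) => t _.
  rewrite normr_id -(real_normK (num_real (_ - _))); move: `|_| => x.
  by have := sqr_ge0 (x - 2^-1); nra.
pose S t := (\sum_(0 <= k <oo) (d k t)%:E)%E.
have d0 k t : D t -> (0 <= (d k t)%:E)%E by move=> _; rewrite lee_fin normr_ge0.
have mS : measurable_fun D (S : measurableTypeR R -> \bar R).
  apply: (@emeasurable_fun_cvg _ _ _ D
    (fun m (t : measurableTypeR R) => \sum_(0 <= k < m) (d k t)%:E)%E) => [m|t Dt].
    apply: emeasurable_sum => k. apply/measurable_EFinP. exact: md.
  by apply: is_cvg_nneseries => k _ _; exact: d0.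
have S0 t : (0 <= S t)%E by apply: nneseries_ge0 => k _ _; rewrite lee_fin normr_ge0.
have IS : mu.-integrable D S.
  apply/integrableP; split=> //.
  under eq_integral do rewrite gee0_abs//.
  rewrite integral_nneseries//; last by move=> k; apply/measurable_EFinP; exact: md.
  apply: (@le_lt_trans _ _ (c / (1 - 2^-1))%:E); last by rewrite ltry.
  apply: lime_le.
    by apply: is_cvg_nneseries => k _ _; apply: integral_ge0; exact: d0.
  apply: nearW => m.
  apply: (@le_trans _ _ (series (geometric c 2^-1) m)%:E); last first.
    rewrite lee_fin geometric_le_lim// ?invr_gt0//.
    by rewrite ger0_norm ?invr_ge0// invf_lt1// ltr1n.
  rewrite /series /= -sumEFin; apply: lee_sum => k _.
  by rewrite itg_EFin// lee_fin; exact: hg.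
have mu_ae : Filter (almost_everywhere mu) by exact: (ae_filter_ringOfSetsType mu).
have ae_fin : {ae mu, forall t, D t -> S t \is a fin_num} := integrable_ae mD IS.
apply: (@filterS _ _ mu_ae _ _ _ ae_fin) => t /[apply] St.
have cd : cvgn (series (fun k => d k t)).
  apply: nnseries_is_cvg => [k|]; first exact: normr_ge0.
  by rewrite ltey_eq St.
have cs : cvgn (series (telescope (fun k => g k t))).
  by apply: normed_cvg; exact: cd.
rewrite (_ : (fun k => g k t) =
    (fun k => g 0%N t + series (telescope (fun k => g k t)) k)).
  by apply: is_cvgD => //; exact: is_cvg_cst.
by apply/funext => k; rewrite -eq_sum_telescope.
Qed.

Lemma limn_einf_le (u : (\bar R)^nat) c : (forall k, (u k <= c)%E) -> (limn_einf u <= c)%E.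
Proof.
move=> h; rewrite limn_einf_lim; apply: lime_le; first exact: is_cvg_einfs.
apply: nearW => k; apply: le_trans (h k).
by apply: ereal_inf_lbound; exists k => /=.
Qed.

(** A subsequence with geometrically decreasing increments converges almost
    everywhere, and Fatou's lemma bounds the distance to its limit. *)
Theorem L2_complete (f_ : nat -> R -> R) : (forall k, L2 D (f_ k)) ->
  (forall e : R, 0 < e -> exists n0, forall i j, (n0 <= i)%N -> (n0 <= j)%N ->
    \int[mu]_(t in D) (f_ i t - f_ j t) ^+ 2 < e) ->
  exists2 f, L2 D f &
    \int[mu]_(t in D) (f_ k t - f t) ^+ 2 @[k --> \oo] --> (0 : R).
Proof.
move=> Lf cau.
have h0 k : 0 < 2^-1 ^+ k :> R by rewrite exprn_gt0// invr_gt0.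
have hh0 k : 0 < (2^-1 ^+ k) ^+ 2 :> R by rewrite exprn_gt0.
have /choice [n_ Hn] : forall k : nat, exists n0, forall i j, (n0 <= i)%N -> (n0 <= j)%N ->
    \int[mu]_(t in D) (f_ i t - f_ j t) ^+ 2 < (2^-1 ^+ k) ^+ 2.
  by move=> k; exact: cau.
(* a sum rather than a maximum: it dominates every n_ m with m <= k as well *)
pose phi k := (\sum_(j < k.+1) n_ j)%N.
have phi_ge m k : (m <= k)%N -> (n_ m <= phi k)%N.
  by move=> mk; rewrite /phi (bigD1 (Ordinal (mk : (m < k.+1)%N)))//= leq_addr.
pose g k := f_ (phi k).
have Lg k : L2 D (g k) by exact: Lf.
have c0 : 0 <= (fine (mu D) + 1) / 2 by rewrite divr_ge0// addr_ge0// fine_ge0.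
have cg : {ae mu, forall t, D t -> cvgn (fun k => g k t)}.
  apply: (ae_cvg_of_summable_steps c0 Lg) => k; rewrite mulrC.
  by apply: L2_dist_L1 => //; apply: Hn; apply: phi_ge.
(* the upper limit is measurable everywhere, also where g diverges *)
pose f t := fine (limn_esup (fun k => (g k t)%:E)).
have mf : meas D f.
  apply: (measurableT_comp (fine_measurable measurableT)).
  by apply: measurable_fun_limn_esup => k; apply/measurable_EFinP; case: (Lg k).
have gf t : cvgn (fun k => g k t) -> g k t @[k --> \oo] --> f t.
  move=> ct; rewrite /f.
  have ce : (g k t)%:E @[k --> \oo] --> (limn (fun k => g k t))%:E.
    by apply: cvg_EFin => //; exact: nearW.
  by have [_ ->] := cvg_limn_einf_sup ce.
have mu_ae : Filter (almost_everywhere mu) by exact: (ae_filter_ringOfSetsType mu).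
have key m i : (n_ m <= i)%N ->
    L2 D (fun t => f t - f_ i t) /\
    \int[mu]_(t in D) (f t - f_ i t) ^+ 2 <= (2^-1 ^+ m) ^+ 2.
  move=> mi.
  pose h k t : \bar R := ((g (k + m)%N t - f_ i t) ^+ 2)%:E.
  have mdiff : meas D (fun t => f t - f_ i t).
    by apply: measurable_funB => //; case: (Lf i).
  have mh k : measurable_fun D (h k : measurableTypeR R -> \bar R).
    apply/measurable_EFinP; apply: measurable_funX.
    by case: (L2_sub (Lg (k + m)%N) (Lf i)).
  have hpos k t : D t -> (0 <= h k t)%E by rewrite lee_fin sqr_ge0.
  have bound : (\int[mu]_(t in D) ((f t - f_ i t) ^+ 2)%:E <= ((2^-1 ^+ m) ^+ 2)%:E)%E.
    have -> : (\int[mu]_(t in D) ((f t - f_ i t) ^+ 2)%:E =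
        \int[mu]_(t in D) limn_einf (h^~ t))%E.
      apply: ge0_ae_eq_integral => //.
      - by apply/measurable_EFinP; exact: measurable_funX.
      - rewrite (_ : (fun t => _) = (fun t => - limn_esup (fun k => - h k t))%E).
          apply: measurableT_comp => //; apply: measurable_fun_limn_esup => k.
          exact: (measurableT_comp _ (mh k)).
        apply/funext => t; rewrite -limn_einfN; congr limn_einf.
        by apply/funext => k; exact: (esym (oppeK _)).
      - by move=> t _; rewrite lee_fin sqr_ge0.
      - move=> t Dt; rewrite limn_einf_lim; apply: lime_ge; first exact: is_cvg_einfs.
        apply: nearW => k; apply: le_ereal_inf_tmp => _ [j _ <-]; exact: hpos.
      - apply: (@filterS _ _ mu_ae _ _ _ cg) => t cgt Dt.
        have ct := gf _ (cgt Dt).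
        have ch : h k t @[k --> \oo] --> ((f t - f_ i t) ^+ 2)%:E.
          apply: cvg_EFin; first exact: nearW.
          have := ct; rewrite -(cvg_shiftn m) => ct'.
          by rewrite expr2; apply: cvgM; apply: cvgB => //; exact: cvg_cst.
        by have [-> _] := cvg_limn_einf_sup ch.
    apply: le_trans (fatou mu mD mh hpos) _.
    apply: limn_einf_le => k.
    rewrite itg_EFin//; last by case: (L2_sub (Lg (k + m)%N) (Lf i)).
    rewrite lee_fin ltW//; apply: Hn => //; apply: phi_ge; exact: leq_addl.
  have I2 : L1 D (fun t => (f t - f_ i t) ^+ 2).
    apply/integrableP; split; first by apply/measurable_EFinP; exact: measurable_funX.
    apply: le_lt_trans (ltry ((2^-1 ^+ m) ^+ 2)); apply: le_trans bound.
    rewrite le_eqVlt; apply/orP; left; apply/eqP; apply: eq_integral => t _ /=.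
    by rewrite ger0_norm// sqr_ge0.
  by split=> //; move: bound; rewrite itg_EFin// lee_fin.
have Lff : L2 D f.
  have [L0 _] := key 0%N _ (leqnn _).
  by apply: (L2_ext mD _ (L2D mD L0 (Lf (n_ 0%N)))) => t _; rewrite subrK.
exists f => //.
apply/cvgrPdist_lt => e e0.
have [m Hm] : exists m, (2^-1 ^+ m) ^+ 2 < e :> R.
  have : (2^-1 : R) ^+ k @[k --> \oo] --> (0 : R).
    by apply: cvg_expr; rewrite ger0_norm ?invr_ge0// invf_lt1// ltr1n.
  move=> /cvgrPdist_lt /(_ _ e0) [m _ Hm]; exists m.
  have := Hm m (leqnn m); rewrite sub0r normrN ger0_norm ?(ltW (h0 m))// => lt.
  apply: le_lt_trans lt; rewrite expr2 ler_piMr ?(ltW (h0 m))//.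
  by rewrite exprn_ile1// ?invr_ge0// invf_le1// ler1n.
exists (n_ m) => // k /= mk; rewrite sub0r normrN ger0_norm; last first.
  by apply: Rintegral_ge0 => t _; rewrite sqr_ge0.
apply: le_lt_trans Hm; have [_] := key m k mk; congr (_ <= _).
by apply: itg_ext => t _; rewrite -sqrrN opprB.
Qed.

End RieszFischer.

(** * Reproducing kernel spaces as images of Hilbert spaces *)

Section SemiHilbert.
Context {R : realType} {V : lmodType R}.
Implicit Types (L A : set V) (N : V -> V -> R).

(** A complete subspace for a form that may be degenerate: controls are not
    identified when they agree almost everywhere.  Completeness is stated with
    squared norms. *)
Record semi_hilbert L N : Prop := {
  sh_zero : L 0;
  sh_lin : forall (a : R) u v, L u -> L v -> L (a *: u + v);
  sh_sym : forall u v, L u -> L v -> N u v = N v u;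
  sh_ip_lin : forall (a : R) u v w, L u -> L v -> L w ->
    N (a *: u + v) w = a * N u w + N v w;
  sh_ge0 : forall u, L u -> 0 <= N u u;
  sh_complete : forall v_ : nat -> V, (forall k, L (v_ k)) ->
    (forall e : R, 0 < e -> exists n0, forall i j, (n0 <= i)%N -> (n0 <= j)%N ->
      N (v_ i - v_ j) (v_ i - v_ j) < e) ->
    exists2 v, L v & N (v_ k - v) (v_ k - v) @[k --> \oo] --> (0 : R)
}.

(** The test value a = - p / (q + 1) is allowed for q = 0 too. *)
Lemma quad_ge0_eq0 (p q : R) :
  0 <= q -> (forall a, 0 <= 2 * a * p + a ^+ 2 * q) -> p = 0.
Proof.
move=> q0 /(_ (- (p / (q + 1)))) h.
have q1 : 0 < q + 1 by rewrite ltr_wpDl.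
have E : 2 * - (p / (q + 1)) * p + (- (p / (q + 1))) ^+ 2 * q =
    - ((p / (q + 1)) ^+ 2 * (q + 2)).
  by field; rewrite gt_eqF.
move: h; rewrite E oppr_ge0 => h.
have : (p / (q + 1)) ^+ 2 * (q + 2) == 0.
  by rewrite eq_le h mulr_ge0 ?sqr_ge0// addr_ge0.
rewrite mulf_eq0 sqrf_eq0 mulf_eq0 invr_eq0 (gt_eqF q1) orbF => /orP[/eqP//|].
by rewrite gt_eqF// ltr_wpDl.
Qed.

Context (L : set V) (N : V -> V -> R) (H : semi_hilbert L N).

Lemma shD u v : L u -> L v -> L (u + v).
Proof. by move=> Lu Lv; rewrite -[u]scale1r; exact: sh_lin H _ _ _ Lu Lv. Qed.

Lemma shZ a u : L u -> L (a *: u).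
Proof.
by move=> Lu; rewrite -[a *: u]addr0; exact: sh_lin H _ _ _ Lu (sh_zero H).
Qed.

Lemma shN u : L u -> L (- u).
Proof. by move=> Lu; rewrite -scaleN1r; exact: shZ. Qed.

Lemma shB u v : L u -> L v -> L (u - v).
Proof. by move=> Lu Lv; exact: shD Lu (shN Lv). Qed.

Lemma sh_Dl u v w : L u -> L v -> L w -> N (u + v) w = N u w + N v w.
Proof. by move=> Lu Lv Lw; rewrite -[u in LHS]scale1r (sh_ip_lin H)// mul1r. Qed.

Lemma sh_0l w : L w -> N 0 w = 0.
Proof.
move=> Lw; have := sh_Dl (sh_zero H) (sh_zero H) Lw.
by rewrite addr0 => /eqP; rewrite -subr_eq0 opprD addNKr oppr_eq0 => /eqP.
Qed.

Lemma sh_Zl a u w : L u -> L w -> N (a *: u) w = a * N u w.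
Proof.
move=> Lu Lw; rewrite -[a *: u]addr0 (sh_ip_lin H)//; last exact: sh_zero H.
by rewrite sh_0l// addr0.
Qed.

Lemma sh_Nl u w : L u -> L w -> N (- u) w = - N u w.
Proof. by move=> Lu Lw; rewrite -scaleN1r sh_Zl// mulN1r. Qed.

Lemma sh_Bl u v w : L u -> L v -> L w -> N (u - v) w = N u w - N v w.
Proof. by move=> Lu Lv Lw; rewrite sh_Dl ?sh_Nl//; exact: shN. Qed.

Lemma sh_Dr u v w : L u -> L v -> L w -> N w (u + v) = N w u + N w v.
Proof.
move=> Lu Lv Lw; rewrite (sh_sym H)//; last exact: shD.
by rewrite sh_Dl// !(sh_sym H (u := w)).
Qed.

Lemma sh_Zr a u w : L u -> L w -> N w (a *: u) = a * N w u.
Proof.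
move=> Lu Lw; rewrite (sh_sym H)//; last exact: shZ.
by rewrite sh_Zl// (sh_sym H).
Qed.

Lemma sh_expand a u v : L u -> L v ->
  N (u + a *: v) (u + a *: v) = N u u + 2 * a * N u v + a ^+ 2 * N v v.
Proof.
move=> Lu Lv; have Lav := shZ a Lv.
rewrite sh_Dl ?sh_Dr//; try exact: shD.
by rewrite !sh_Zr// !sh_Zl// (sh_sym H (u := v) (v := u))//; ring.
Qed.

Lemma sh_cs u v : L u -> L v -> N u v ^+ 2 <= N u u * N v v.
Proof.
move=> Lu Lv; have h a : 0 <= N u u + 2 * a * N u v + a ^+ 2 * N v v.
  by rewrite -sh_expand//; apply: (sh_ge0 H); apply: shD => //; exact: shZ.
have := sh_ge0 H Lv; rewrite le_eqVlt => /predU1P[v0|v0]; last first.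
  have := h (- (N u v / N v v)).
  have -> : N u u + 2 * - (N u v / N v v) * N u v + (- (N u v / N v v)) ^+ 2 * N v v =
     (N u u * N v v - N u v ^+ 2) / N v v by field; rewrite gt_eqF.
  by rewrite pmulr_lge0 ?invr_gt0// subr_ge0.
rewrite -v0 mulr0; have [->|uv0] := eqVneq (N u v) 0; first by rewrite expr0n.
have := h (- ((N u u + 1) / (2 * N u v))).
rewrite -v0 mulr0 addr0.
have -> : 2 * - ((N u u + 1) / (2 * N u v)) * N u v = - (N u u + 1) by field.
by rewrite opprD addrA subrr add0r oppr_ge0 ler10.
Qed.

Lemma sh_norm_cs u v : L u -> L v -> `|N u v| <= Num.sqrt (N u u) * Num.sqrt (N v v).
Proof.
move=> Lu Lv; rewrite -sqrtrM ?(sh_ge0 H)// -sqrtr_sqr.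
by rewrite ler_wsqrtr// sh_cs.
Qed.

Lemma sh_weak_cvg (v_ : nat -> V) v w : (forall k, L (v_ k)) -> L v -> L w ->
  N (v_ k - v) (v_ k - v) @[k --> \oo] --> (0 : R) ->
  N (v_ k - v) w @[k --> \oo] --> (0 : R).
Proof.
move=> Lv_ Lv Lw cv; apply/norm_cvg0P.
apply: (@squeeze_cvgr _ _ _ _ (fun=> 0)
  (fun k => Num.sqrt (N (v_ k - v) (v_ k - v)) * Num.sqrt (N w w))).
- apply: nearW => k; rewrite normr_ge0 /=.
  by apply: sh_norm_cs => //; exact: shB.
- exact: cvg_cst.
- rewrite -(mul0r (Num.sqrt (N w w))); apply: cvgMr_tmp.
  rewrite -[X in _ --> X](@sqrtr0 R).
  by apply: continuous_cvg => //; exact: sqrt_continuous.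
Qed.

Definition norm_minimizer (A : set V) (v : V) :=
  A v /\ forall v', A v' -> N v v <= N v' v'.

(** A minimizing sequence is Cauchy by the parallelogram identity. *)
Lemma exists_norm_minimizer (A : set V) : A !=set0 -> A `<=` L ->
  (forall u v, A u -> A v -> A (2^-1 *: (u + v))) ->
  (forall (v_ : nat -> V) v, (forall k, A (v_ k)) -> L v ->
    N (v_ k - v) (v_ k - v) @[k --> \oo] --> (0 : R) -> A v) ->
  exists v, norm_minimizer A v.
Proof.
move=> [a0 Aa0] AL Amid Acl.
pose S := [set N v v | v in A].
have hS : has_inf S.
  split; first by exists (N a0 a0), a0.
  by exists 0 => _ [v Av <-]; exact: sh_ge0 H _ (AL _ Av).
pose m := inf S.
have mle v : A v -> m <= N v v.
  by move=> Av; apply: ge_inf; [case: hS|exists v].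
have eps_gt0 k : 0 < (k.+1%:R)^-1 :> R by rewrite invr_gt0.
have /choice [v_ Hv_] : forall k : nat, exists v, A v /\ N v v < m + (k.+1%:R)^-1.
  move=> k; have [_ [v Av <-] h] := inf_adherent (eps_gt0 k) hS.
  by exists v.
have Av_ k := proj1 (Hv_ k); have vlt k := proj2 (Hv_ k).
have Lv_ k := AL _ (Av_ k).
have para u v : A u -> A v -> N (u - v) (u - v) <= 2 * N u u + 2 * N v v - 4 * m.
  move=> Au Av; have Lu := AL _ Au; have Lv := AL _ Av.
  have := mle _ (Amid _ _ Au Av).
  rewrite sh_Zl ?sh_Zr//; try (by exact: shD); try (by apply: shZ; exact: shD).
  have := sh_expand (-1) Lu Lv; have := sh_expand 1 Lu Lv.
  rewrite scale1r scaleN1r sqrrN expr1n => -> ->; lra.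
have [v Lv cv] : exists2 v, L v & N (v_ k - v) (v_ k - v) @[k --> \oo] --> (0 : R).
  apply: (sh_complete H) => // e e0.
  have [n0 Hn0] : exists n0 : nat, (n0.+1%:R)^-1 < e / 4.
    have e4 : 0 < e / 4 by rewrite divr_gt0.
    exists (Num.truncn (e / 4)^-1); rewrite invf_plt ?posrE//.
    by rewrite truncnS_gt.
  exists n0 => i j ni nj.
  apply: le_lt_trans (para _ _ (Av_ i) (Av_ j)) _.
  have := vlt i; have := vlt j.
  have mono k : (n0 <= k)%N -> (k.+1%:R)^-1 <= (n0.+1%:R)^-1 :> R.
    by move=> nk; rewrite lef_pV2 ?posrE// ler_nat.
  have := mono _ ni; have := mono _ nj; move: Hn0.
  move: (n0.+1%:R^-1) (i.+1%:R^-1) (j.+1%:R^-1) => x y z; lra.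
have Av := Acl _ _ Av_ Lv cv.
exists v; split=> // v' Av'; apply: le_trans (mle _ Av').
have w := sh_weak_cvg Lv_ Lv Lv cv.
have inv_cvg : (k.+1%:R)^-1 @[k --> \oo] --> (0 : R) by exact: cvg_harmonic.
have c1 : N v v + 2 * N (v_ k - v) v @[k --> \oo] --> N v v.
  rewrite -[X in _ --> X]addr0; apply: cvgD; first exact: cvg_cst.
  by rewrite -(mulr0 2); exact: cvgMl_tmp.
have c2 : m + (k.+1%:R)^-1 @[k --> \oo] --> m.
  by rewrite -[X in _ --> X]addr0; apply: cvgD => //; exact: cvg_cst.
apply: (ler_cvg_to c1 c2); apply: nearW => k.
apply: le_trans (ltW (vlt k)).
have LB := shB (Lv_ k) Lv.
have := sh_expand 1 Lv LB.
rewrite scale1r subrKC => ->.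
have := sh_ge0 H LB; rewrite (sh_sym H Lv LB) expr1n; lra.
Qed.

End SemiHilbert.

Section FeatureMap.
Context {R : realType} {U : Type} {n : nat} {V : lmodType R}.
Variables (L : set V) (N : V -> V -> R) (Ev : V -> U -> 'cV[R]_n) (D : set U).
Variables (W : U -> 'rV[R]_n -> V).
Hypotheses (H : semi_hilbert L N)
  (Ev_lin : forall a u v t, L u -> L v -> D t ->
    Ev (a *: u + v) t = a *: Ev u t + Ev v t)
  (W_L : forall t z, D t -> L (W t z))
  (W_repr : forall t z v, D t -> L v -> (z *m Ev v t) 0 0 = N v (W t z)).

Definition fiber (f : U -> 'cV[R]_n) : set V :=
  [set v | L v /\ forall t, D t -> Ev v t = f t].

Lemma Ev_B u v t : L u -> L v -> D t -> Ev (u - v) t = Ev u t - Ev v t.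
Proof.
move=> Lu Lv Dt; rewrite -[- v]scaleN1r addrC Ev_lin// scaleN1r addrC.
by [].
Qed.

Lemma row_sep (x : 'cV[R]_n) : (forall z : 'rV[R]_n, (z *m x) 0 0 = 0) -> x = 0.
Proof.
move=> h; apply: dotp_eq0; rewrite -(h x^T) mxE; apply: eq_bigr => i _.
by rewrite mxE.
Qed.

(** Fibers are closed because evaluations are continuous, being represented by
    the elements W. *)
Lemma exists_fiber_minimizer f : fiber f !=set0 ->
  exists v, norm_minimizer N (fiber f) v.
Proof.
move=> f0; apply: (exists_norm_minimizer H f0).
- by move=> v [].
- move=> u v [Lu uf] [Lv vf]; split=> [|t Dt]; first exact: shZ H _ _ (shD H Lu Lv).
  rewrite scalerDr Ev_lin//; last exact: shZ H _ _ Lv.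
  rewrite -[_ *: v]addr0 Ev_lin//; last exact: sh_zero H.
  have -> : Ev 0 t = 0 by rewrite -(subrr u) Ev_B// subrr.
  by rewrite uf// vf// addr0; apply/matrixP => i j; rewrite !mxE; field.
- move=> v_ v Av Lv cv; split=> // t Dt; apply/esym/eqP; rewrite -subr_eq0; apply/eqP.
  apply: row_sep => z.
  have Lv_ k : L (v_ k) by case: (Av k).
  have w := sh_weak_cvg H Lv_ Lv (W_L z Dt) cv.
  have e : (fun k => N (v_ k - v) (W t z)) = cst ((z *m (f t - Ev v t)) 0 0).
    apply/funext => k; rewrite /= -W_repr//; last exact: shB H _ _ (Lv_ k) Lv.
    by rewrite Ev_B//; have [_ ->] := Av k.
  have c : cst ((z *m (f t - Ev v t)) 0 0) @ \oo --> (z *m (f t - Ev v t)) 0 0.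
    exact: cvg_cst.
  by rewrite e in w; apply: (@cvg_unique _ (@norm_hausdorff _ R) _ _ _ _ c w).
Qed.

(** Moving v along the kernel stays in the fiber, so the derivative of the
    squared norm in that direction vanishes. *)
Lemma minimizer_orthogonal f v k : norm_minimizer N (fiber f) v ->
  fiber (fun=> 0) k -> N v k = 0.
Proof.
move=> [[Lv vf] vmin] [Lk k0].
apply: (@quad_ge0_eq0 _ _ (N k k)); first exact: sh_ge0 H _ Lk.
move=> a; have := vmin (v + a *: k).
rewrite (sh_expand H)// -addrA lerDl; apply; split.
  exact: shD H _ _ Lv (shZ H a Lk).
by move=> t Dt; rewrite addrC Ev_lin// k0// scaler0 add0r vf.
Qed.

Variables (E : set (U -> 'cV[R]_n)) (K : U -> U -> 'M[R]_n).
Variables (ip : (U -> 'cV[R]_n) -> (U -> 'cV[R]_n) -> R) (rep : (U -> 'cV[R]_n) -> V).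
Hypotheses (EP : forall f, E f <-> fiber f !=set0)
  (W_K : forall s t z, D s -> D t -> Ev (W t z) s = K s t *m z^T)
  (rep_min : forall f, E f -> norm_minimizer N (fiber f) (rep f))
  (ipE : forall f g, E f -> E g -> ip f g = N (rep f) (rep g)).

(** A minimal preimage is orthogonal to the kernel of Ev.  Hence N (rep f) v depends
    on v only through its image, which makes [ip] bilinear although [rep] is merely
    a choice, and makes W t z usable in place of the minimal preimage of its image. *)
Theorem rkhs_of_feature_map : is_rkhs D E ip K.
Proof.
have rep_L f : E f -> L (rep f) by move=> /rep_min [[]].
have rep_f f t : E f -> D t -> Ev (rep f) t = f t by move=> /rep_min [[_ h] _]; exact: h.
have E_intro v f : L v -> (forall t, D t -> Ev v t = f t) -> E f.
  by move=> Lv vf; apply/EP; exists v.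
have orth f k : E f -> fiber (fun=> 0) k -> N (rep f) k = 0.
  by move=> /rep_min; exact: minimizer_orthogonal.
have ker_sub f u v : fiber f u -> fiber f v -> fiber (fun=> 0) (u - v).
  move=> [Lu uf] [Lv vf]; split=> [|t Dt]; first exact: shB H _ _ Lu Lv.
  by rewrite Ev_B// uf// vf// subrr.
have rep_ip f g v : E f -> fiber g v -> N (rep f) (rep g) = N (rep f) v.
  move=> Ef gv; have Eg : E g by apply/EP; exists v.
  have gg : fiber g (rep g) by case: (rep_min Eg).
  apply/eqP; rewrite -subr_eq0 -(orth f _ Ef (ker_sub _ _ _ gg gv)); apply/eqP.
  have Lf := rep_L _ Ef; have [Lr _] := gg; have [Lv _] := gv.
  rewrite (sh_sym H Lf (shB H Lr Lv)) (sh_Bl H)//.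
  by rewrite (sh_sym H Lr Lf) (sh_sym H Lv Lf).
have lin_fib a f g : E f -> E g -> fiber (fun t => a *: f t + g t) (a *: rep f + rep g).
  move=> Ef Eg; split; first by apply: (sh_lin H); exact: rep_L.
  by move=> t Dt; rewrite Ev_lin ?rep_f//; exact: rep_L.
have E_lin a f g : E f -> E g -> E (fun t => a *: f t + g t).
  by move=> Ef Eg; apply/EP; exists (a *: rep f + rep g); exact: lin_fib.
have sub_fib f g : E f -> E g -> fiber (fun t => f t - g t) (rep f - rep g).
  move=> Ef Eg; split; first by apply: (shB H); exact: rep_L.
  by move=> t Dt; rewrite Ev_B ?rep_f//; exact: rep_L.
have E_sub f g : E f -> E g -> E (fun t => f t - g t).
  by move=> Ef Eg; apply/EP; exists (rep f - rep g); exact: sub_fib.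
have ip_sub f g : E f -> E g ->
    ip (fun t => f t - g t) (fun t => f t - g t) = N (rep f - rep g) (rep f - rep g).
  move=> Ef Eg; have Efg := E_sub f g Ef Eg; have fib := sub_fib f g Ef Eg.
  have [Ld _] := fib; have Lfg := rep_L _ Efg.
  have Lf := rep_L _ Ef; have Lg := rep_L _ Eg.
  rewrite ipE// (rep_ip _ _ _ Efg fib) (sh_sym H Lfg Ld) (sh_Bl H)//.
  rewrite [RHS](sh_Bl H)//.
  by rewrite (rep_ip f _ _ Ef fib) (rep_ip g _ _ Eg fib).
have ip_point t z f : D t -> E f -> (z *m f t) 0 0 = N (rep f) (W t z).
  by move=> Dt Ef; rewrite -(rep_f f t Ef Dt) W_repr//; exact: rep_L.
have W_fib t z : D t -> fiber (fun s => K s t *m z^T) (W t z).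
  by move=> Dt; split=> [|s Ds]; [exact: W_L|exact: W_K].
have EW t z : D t -> E (fun s => K s t *m z^T).
  by move=> Dt; apply/EP; exists (W t z); exact: W_fib.
split=> //; last first.
  by move=> t z f Dt Ef; rewrite ip_point// ipE ?(rep_ip _ _ _ Ef (W_fib t z Dt))//; exact: EW.
split=> //.
- apply: (E_intro 0); first exact: sh_zero H.
  move=> t Dt; have L0 := sh_zero H.
  by rewrite -(subrr 0) Ev_B// subrr.
- by move=> f g Ef fg; apply: (E_intro (rep f)) => [|t Dt]; rewrite ?rep_f ?fg//; exact: rep_L.
- by move=> f g Ef Eg; rewrite !ipE// (sh_sym H)//; exact: rep_L.
- move=> a f g h Ef Eg Eh; have Efg := E_lin a f g Ef Eg.
  have Lf := rep_L _ Ef; have Lg := rep_L _ Eg; have Lh := rep_L _ Eh.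
  rewrite !ipE// (sh_sym H (rep_L _ Efg) Lh) (rep_ip _ _ _ Eh (lin_fib a f g Ef Eg)).
  rewrite (sh_sym H)//; last exact: sh_lin H _ _ _ Lf Lg.
  by rewrite (sh_ip_lin H).
- by move=> f Ef; rewrite ipE//; apply: (sh_ge0 H); exact: rep_L.
- move=> f Ef; rewrite ipE//; have Lf := rep_L _ Ef; split=> [f0 t Dt|f0].
    apply: row_sep => z; rewrite ip_point//; apply/eqP; rewrite -sqrf_eq0 eq_le sqr_ge0 andbT.
    by rewrite (le_trans (sh_cs H Lf (W_L z Dt)))// f0 mul0r.
  apply: orth => //; split=> // t Dt; by rewrite rep_f// f0.
- move=> f_ Ef_ cau.
  have Lf_ k : L (rep (f_ k)) by exact: rep_L.
  have [v Lv cv] : exists2 v, L v &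
      N (rep (f_ k) - v) (rep (f_ k) - v) @[k --> \oo] --> (0 : R).
    apply: (sh_complete H) => // e e0.
    have se0 : 0 < Num.sqrt e by rewrite sqrtr_gt0.
    have [n0 Hn0] := cau _ se0; exists n0 => i j ni nj.
    by have := Hn0 i j ni nj; rewrite ip_sub// ltr_sqrt.
  have Ev_v : E (Ev v) by exact: (E_intro v).
  exists (Ev v) => //.
  apply: (@squeeze_cvgr _ _ _ _ (fun=> 0)
      (fun k => Num.sqrt (N (rep (f_ k) - v) (rep (f_ k) - v)))).
  + apply: nearW => k; rewrite sqrtr_ge0 /= ler_wsqrtr// ipE; try exact: E_sub.
    have [_ ] := rep_min (E_sub _ _ (Ef_ k) Ev_v); apply; split.
      exact: shB H _ _ (Lf_ k) Lv.
    by move=> t Dt; rewrite Ev_B// rep_f.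
  + exact: cvg_cst.
  + rewrite -[X in _ --> X](@sqrtr0 R).
    by apply: continuous_cvg => //; exact: sqrt_continuous.
Qed.

End FeatureMap.

(** * The Hilbert space of controls and initial states *)

Section ControlSpace.
Context {R : realType}.
Notation mu := (@lebesgue_measure R).
Notation meas := (@measurable_fun _ _ (measurableTypeR R) R).
#[local] Hint Resolve itv_meas : core.

Lemma real_cauchy_cvg (x : nat -> R) :
  (forall e : R, 0 < e -> exists n0, forall i j, (n0 <= i)%N -> (n0 <= j)%N ->
    (x i - x j) ^+ 2 < e) -> cvgn x.
Proof.
move=> h; apply/cauchy_cvgP/cauchy_exP => e e0.
have [n0 Hn0] := h _ (exprn_gt0 2 e0).
exists (x n0); exists n0 => // k /= nk; rewrite /ball /=.
have := Hn0 n0 k (leqnn _) nk.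
by rewrite -(real_normK (num_real _)) ltr_pXn2r ?nnegrE// ltW.
Qed.

Variables (a b : R) (n d : nat) (M : 'M[R]_n).
Hypotheses (M_sym : M^T = M) (M_ge1 : forall xi, dotp xi xi <= dotp (M *m xi) xi).

(** M is the weight that the completion of squares puts on the initial state. *)
Definition control_ip (p q : (R -> 'cV[R]_d) * 'cV[R]_n) : R :=
  dotp (M *m p.2) q.2 + \int[mu]_(t in `[a, b]) dotp (p.1 t) (q.1 t).

Definition controls : set ((R -> 'cV[R]_d) * 'cV[R]_n) :=
  [set p | Lmx 2%:E a b p.1].

Lemma L1_dotp k (u v : R -> 'cV[R]_k) : Lmx 2%:E a b u -> Lmx 2%:E a b v ->
  L1 `[a, b] (fun t => dotp (u t) (v t)).
Proof.
move=> hu hv; have /Lmx1P /(_ 0 0) := Lmx2_mul_Lmx1 (Lmx2_tr hu) hv.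
by apply: L1_ext => // t _; rewrite dotpE.
Qed.

Lemma itv_fin : (mu `[a, b]%classic < +oo)%E.
Proof.
rewrite lebesgue_measure_itv /=; case: ifPn => // _.
by rewrite -EFinB ltry.
Qed.

Lemma control_semi_hilbert : semi_hilbert controls control_ip.
Proof.
split.
- apply/Lmx2P => i j; apply: (L2_ext (itv_meas a b) _ (L2_0 (itv_meas a b))) => t _.
  by rewrite mxE.
- by move=> c u v hu hv; exact: Lmx2_add (Lmx2_scale c hu) hv.
- move=> u v hu hv; congr (_ + _); first by rewrite dotp_mull M_sym dotpC.
  by apply: itg_ext => // t _; rewrite dotpC.
- move=> c u v w hu hv hw; rewrite /control_ip /=.
  have -> : \int[mu]_(t in `[a, b]) dotp (c *: u.1 t + v.1 t) (w.1 t) =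
      \int[mu]_(t in `[a, b]) (c * dotp (u.1 t) (w.1 t) + dotp (v.1 t) (w.1 t)).
    by apply: itg_ext => // t _; rewrite dotpDl dotpZl.
  rewrite itgD//; [|by apply: L1Z => //; exact: L1_dotp|exact: L1_dotp].
  rewrite itgZ//; last exact: L1_dotp.
  rewrite mulmxDr -scalemxAr dotpDl dotpZl; ring.
- move=> u hu; apply: addr_ge0; first exact: le_trans (dotp_ge0 _) (M_ge1 _).
  by apply: Rintegral_ge0 => t _; exact: dotp_ge0.
- move=> v_ hv_ cau.
  have hsub i j : Lmx 2%:E a b (fun t => (v_ i).1 t - (v_ j).1 t).
    exact: Lmx2_add (hv_ i) (Lmx2_opp (hv_ j)).
  have sq_le k (x : 'cV[R]_k) l : x l 0 ^+ 2 <= dotp x x.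
    rewrite /dotp (bigD1 l)//= -expr2 lerDl sumr_ge0// => l' _.
    by rewrite -expr2 sqr_ge0.
  have cau_u l : forall e : R, 0 < e -> exists n0, forall i j, (n0 <= i)%N -> (n0 <= j)%N ->
      \int[mu]_(t in `[a, b]) ((v_ i).1 t l 0 - (v_ j).1 t l 0) ^+ 2 < e.
    move=> e e0; have [n0 Hn0] := cau e e0; exists n0 => i j ni nj.
    apply: le_lt_trans (Hn0 i j ni nj); rewrite /control_ip /=.
    apply: (@le_trans _ _ (\int[mu]_(t in `[a, b])
        dotp ((v_ i).1 t - (v_ j).1 t) ((v_ i).1 t - (v_ j).1 t))).
      apply: le_itg => //; [| |].
      + have /Lmx2P /(_ l 0) [_] := hsub i j.
        by apply: L1_ext => // t _; rewrite !mxE.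
      + exact: L1_dotp.
      + by move=> t _; have := sq_le _ ((v_ i).1 t - (v_ j).1 t) l; rewrite !mxE.
    by rewrite lerDr; exact: le_trans (dotp_ge0 _) (M_ge1 _).
  have cau_x l : forall e : R, 0 < e -> exists n0, forall i j, (n0 <= i)%N -> (n0 <= j)%N ->
      ((v_ i).2 l 0 - (v_ j).2 l 0) ^+ 2 < e.
    move=> e e0; have [n0 Hn0] := cau e e0; exists n0 => i j ni nj.
    apply: le_lt_trans (Hn0 i j ni nj); rewrite /control_ip /=.
    apply: (@le_trans _ _ (dotp ((v_ i).2 - (v_ j).2) ((v_ i).2 - (v_ j).2))).
      by have := sq_le _ ((v_ i).2 - (v_ j).2) l; rewrite !mxE.
    apply: le_trans (M_ge1 _) _; rewrite lerDl.
    by apply: Rintegral_ge0 => t _; exact: dotp_ge0.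
  have L2v k l : L2 `[a, b] (fun t => (v_ k).1 t l 0) by have /Lmx2P := hv_ k; apply.
  have /choice [g Hg] : forall l, exists f, L2 `[a, b] f /\
      \int[mu]_(t in `[a, b]) ((v_ k).1 t l 0 - f t) ^+ 2 @[k --> \oo] --> (0 : R).
    move=> l; have [f Lf cf] := L2_complete (itv_meas a b) itv_fin (L2v ^~ l) (cau_u l).
    by exists f.
  pose x : 'cV[R]_n := \col_l limn (fun k => (v_ k).2 l 0).
  pose v : (R -> 'cV[R]_d) * 'cV[R]_n := (fun t => \col_l g l t, x).
  have hv : controls v.
    apply/Lmx2P => l j; apply: (L2_ext (itv_meas a b) _ (proj1 (Hg l))) => t _.
    by rewrite mxE.
  exists v => //.
  have cx : mxcvg (fun k => (v_ k).2 - x) 0.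
    move=> l j; rewrite ord1 mxE; under eq_fun do rewrite !mxE.
    rewrite -(subrr (limn (fun k => (v_ k).2 l 0))); apply: cvgB; last exact: cvg_cst.
    exact: real_cauchy_cvg (cau_x l).
  rewrite -(addr0 0); apply: cvgD.
    have := mxcvgM (mxcvg_tr (mxcvgM (@mxcvg_cst _ _ _ M) cx)) cx.
    by move=> /(_ 0 0); rewrite mulmx0 mxE; under eq_fun do rewrite -dotpE.
  have -> : (fun k => \int[mu]_(t in `[a, b])
        dotp ((v_ k - v).1 t) ((v_ k - v).1 t)) =
      (fun k => \sum_l \int[mu]_(t in `[a, b]) ((v_ k).1 t l 0 - g l t) ^+ 2).
    apply/funext => k; rewrite -itg_sum//.
      apply: itg_ext => // t _; apply: eq_bigr => l _.
      by rewrite !mxE expr2.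
    move=> l; have /Lmx2P /(_ l 0) [_] := Lmx2_add (hv_ k) (Lmx2_opp hv).
    by apply: L1_ext => // t _; rewrite !mxE.
  rewrite (_ : nbhs 0 = nbhs (\sum_(l < d) (0 : R))); last by rewrite big1.
  by apply: (cvg_big add_continuous) => l _; exact: (proj2 (Hg l)).
Qed.

End ControlSpace.

(** * The closed-loop system *)

(** The integrand of the completion of squares: the left-hand side is the velocity
    of <Sigma x1, x2> with Sigma' replaced by its value in the Riccati equation. *)
Lemma riccati_pointwise (R : realType) (n d : nat) (S F C : 'M[R]_n)
    (B : 'M[R]_(n, d)) (x1 x2 : 'cV[R]_n) (u1 u2 : 'cV[R]_d) : S^T = S ->
  dotp (- (S *m F + F^T *m S - S *m (B *m B^T) *m S + C) *m x1
        + S *m (F *m x1 + B *m u1)) x2 + dotp (S *m x1) (F *m x2 + B *m u2) =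
  dotp (u1 + B^T *m S *m x1) (u2 + B^T *m S *m x2)
  + -1 * (dotp u1 u2 + dotp (C *m x1) x2).
Proof.
move=> Ss.
rewrite !mulmxDr !mulNmx !mulmxDl !mulNmx !(dotpDl, dotpDr, dotpNl).
have -> : dotp (F^T *m S *m x1) x2 = dotp (S *m x1) (F *m x2).
  by rewrite -mulmxA dotp_mull trmxK.
have -> : dotp (S *m (B *m B^T) *m S *m x1) x2 =
    dotp (B^T *m S *m x1) (B^T *m S *m x2).
  rewrite !(mulmxA S) -!mulmxA dotp_mull Ss dotp_mull.
  by [].
have -> : dotp (S *m (B *m u1)) x2 = dotp u1 (B^T *m S *m x2).
  by rewrite dotp_mull Ss dotp_mull mulmxA.
have -> : dotp (S *m x1) (B *m u2) = dotp (B^T *m S *m x1) u2.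
  by rewrite dotp_mulr mulmxA.
by rewrite (mulmxA S F); ring.
Qed.

Section ClosedLoop.
Context {R : realType} {n m d : nat}.
Notation mu := (@lebesgue_measure R).
Notation meas := (@measurable_fun _ _ (measurableTypeR R) R).
#[local] Hint Resolve itv_meas : core.
Variables (t0 T : R) (F : R -> 'M[R]_n) (G : R -> 'M[R]_(n, d))
  (H : R -> 'M[R]_(m, n)) (Q : R -> 'M[R]_d) (W : R -> 'M[R]_m)
  (Pi0 SigmaT : 'M[R]_n) (Sigma : R -> 'M[R]_n) (Phi : R -> R -> 'M[R]_n)
  (Z : set R).
Hypotheses (t0_le_T : t0 <= T)
  (F_L1 : Lmx 1 t0 T F) (G_L2 : Lmx 2%:E t0 T G) (Q_L1 : Lmx 1 t0 T Q)
  (Pi0_psd : is_psd Pi0)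
  (GQG_L1 : Lmx 1 t0 T (fun t => G t *m Q t *m (G t)^T))
  (Sigma_sol : is_riccati_solution t0 T F G H Q W SigmaT Sigma)
  (Phi_sol : is_transition_matrix t0 T F G Q Sigma Phi)
  (Z_meas : @measurable _ (measurableTypeR R) Z) (Z_null : mu Z = 0)
  (Q_psd : forall t, t \in `[t0, T] -> ~ Z t -> is_psd (Q t)).

Let t0_in : t0 \in `[t0, T]. Proof. by rewrite in_itv /= lexx. Qed.
Let T_in : T \in `[t0, T]. Proof. by rewrite in_itv /= lexx t0_le_T. Qed.

Let Zc_meas : @measurable _ (measurableTypeR R) (~` Z).
Proof. exact: measurableC. Qed.

Let ae_offZ (P : R -> Prop) : (forall t, ~ Z t -> P t) -> {ae mu, forall t, P t}.
Proof.
move=> h; exists Z; split=> // t /= nPt.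
by apply: contrapT => nZ; apply: nPt; exact: h.
Qed.

(** Cutting Q off on Z makes it positive semidefinite everywhere on the interval,
    so that its square root is a measurable function. *)
Let mask (t : R) : R := \1_(~` Z) t.

Let maskZ t : Z t -> mask t = 0.
Proof. by move=> Zt; rewrite /mask indicE memNset//; exact. Qed.

Let maskN t : ~ Z t -> mask t = 1.
Proof. by move=> Zt; rewrite /mask indicE mem_set. Qed.

Let P := psd_sqrt Pi0.
Let Qm t := mask t *: Q t.
Let B t := G t *m psd_sqrt (Qm t).
Let A t := F t - G t *m Q t *m (G t)^T *m Sigma t.
Let C t := (H t)^T *m invmx (W t) *m H t.
Let M := 1%:M + P *m Sigma t0 *m P.

Let P_psd : is_psd P. Proof. by have [] := psd_sqrtP Pi0_psd. Qed.

Let Qm_psd t : t \in `[t0, T] -> is_psd (Qm t).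
Proof.
move=> tI; rewrite /Qm; have [Zt|Zt] := pselect (Z t).
  by rewrite maskZ// scale0r; exact: is_psd0.
by rewrite maskN// scale1r; exact: Q_psd.
Qed.

Let BBt_masked t : t \in `[t0, T] ->
  B t *m (B t)^T = mask t *: (G t *m Q t *m (G t)^T).
Proof.
move=> tI; have [[Ss _] S2 _] := psd_sqrtP (Qm_psd tI).
rewrite /B trmx_mul Ss -!mulmxA (mulmxA (psd_sqrt _)) S2 /Qm.
by rewrite -scalemxAl -scalemxAr.
Qed.

Let BBt t : t \in `[t0, T] -> ~ Z t -> B t *m (B t)^T = G t *m Q t *m (G t)^T.
Proof. by move=> tI Zt; rewrite BBt_masked// maskN// scale1r. Qed.

(** The squared entries of B are dominated by the diagonal of B B^T, which is that
    of G Q G^T off Z; so the integrability of G Q G^T is what makes B square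
    integrable. *)
Let B_L2 : Lmx 2%:E t0 T B.
Proof.
have mG : mxall (meas `[t0, T]) G by move=> i j; have /Lmx2P /(_ i j) [] := G_L2.
have mQ : mxall (meas `[t0, T]) Q.
  by move=> i j; have /Lmx1P /(_ i j) /L1_meas := Q_L1.
have mB : mxall (meas `[t0, T]) B.
  apply: meas_mul => //; apply: psd_sqrt_meas => //.
  by apply: meas_scale => //; exact: measurable_indic.
apply/Lmx2P => i j.
have /Lmx1P /(_ i i) /(L1_norm) Ig := GQG_L1.
apply: (L2_le (itv_meas t0 T) (mB i j) Ig) => t tI.
apply: (@le_trans _ _ ((B t *m (B t)^T) i i)).
  have -> : (B t *m (B t)^T) i i = \sum_k B t i k ^+ 2.
    by rewrite [LHS]mxE; apply: eq_bigr => k _; rewrite [_^T k i]mxE expr2.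
  by rewrite (bigD1 j)//= lerDl sumr_ge0// => k _; rewrite sqr_ge0.
rewrite BBt_masked// mxE; have [Zt|Zt] := pselect (Z t).
  by rewrite maskZ// mul0r.
by rewrite maskN// mul1r ler_norm.
Qed.

Let Sigma_sym t : t \in `[t0, T] -> (Sigma t)^T = Sigma t.
Proof. by move=> tI; have [/(_ t tI) []] := Sigma_sol. Qed.

Let Sigma_mbdd : mxall (mbdd t0 T) Sigma.
Proof. by have [_ h _] := Sigma_sol; exact: (ac_mbdd t0_le_T h). Qed.

Let A_L1 : Lmx 1 t0 T A.
Proof.
exact: Lmx1_add F_L1 (Lmx1_opp (Lmx1_mulr GQG_L1 Sigma_mbdd)).
Qed.

Let Phi_ac t : t \in `[t0, T] ->
  ac_deriv t0 T (Phi^~ t) (fun tau => A tau *m Phi tau t) /\ Phi t t = 1%:M.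
Proof. exact: Phi_sol. Qed.

(** Read off the Riccati equation, all other terms of which are integrable. *)
Let C_L1 : Lmx 1 t0 T C.
Proof.
have [_ [hS _] _] := Sigma_sol.
have h1 := Lmx1_mull Sigma_mbdd F_L1.
have h2 := Lmx1_mulr (Lmx1_tr F_L1) Sigma_mbdd.
have h3 := Lmx1_mull Sigma_mbdd (Lmx1_mulr GQG_L1 Sigma_mbdd).
have := Lmx1_add (Lmx1_add (Lmx1_opp hS) (Lmx1_opp (Lmx1_add h1 h2))) h3.
apply: Lmx1_ext => t _; rewrite opprK /C !mulmxA.
move: (_ *m H t) (Sigma t *m F t) (_ *m Sigma t) (Sigma t *m _ *m _ *m _ *m _).
by move=> c s1 s2 s3; rewrite addrC addrA addrAC; apply/matrixP => i j; rewrite !mxE; ring.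
Qed.

Let M_sym : M^T = M.
Proof.
rewrite /M linearD/= trmx1; congr (_ + _).
by rewrite !trmx_mul (proj1 P_psd) Sigma_sym// mulmxA.
Qed.

Let M_ge1 xi : dotp xi xi <= dotp (M *m xi) xi.
Proof.
rewrite /M mulmxDl mul1mx dotpDl lerDl.
have [/(_ t0 t0_in) Sp _ _] := Sigma_sol.
by have [_] := is_psd_sandwich Sp P_psd; apply.
Qed.

Let M_unit : M \in unitmx.
Proof.
rewrite unitmxE unitfE; apply/det0P => -[v /eqP v0 vM]; apply: v0.
have /dotp_eq0 : dotp v^T v^T = 0.
  apply/eqP; rewrite eq_le dotp_ge0 andbT (le_trans (M_ge1 _))//.
  by rewrite -M_sym -trmx_mul vM trmx0 dotp0l.
by move=> /(congr1 trmx); rewrite trmxK trmx0.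
Qed.

Let N : (R -> 'cV[R]_d) * 'cV[R]_n -> _ -> R := control_ip t0 T M.
Let L : set ((R -> 'cV[R]_d) * 'cV[R]_n) := @controls R t0 T n d.

Let N_hilbert : semi_hilbert L N.
Proof. exact: control_semi_hilbert. Qed.

(** The trajectory of the closed loop driven by a feedback control and an initial
    state. *)
Let Ev (p : (R -> 'cV[R]_d) * 'cV[R]_n) : R -> 'cV[R]_n :=
  duhamel t0 Phi (P *m p.2) (fun s => B s *m p.1 s).

Let Bv_L1 v : Lmx 2%:E t0 T v -> Lmx 1 t0 T (fun s => B s *m v s : 'cV[R]_n).
Proof. exact: Lmx2_mul_Lmx1 B_L2. Qed.

Let Ev_ac p : L p ->
  ac_deriv t0 T (Ev p) (fun t => A t *m Ev p t + B t *m p.1 t).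
Proof. by move=> Lp; apply: duhamel_ac => //; exact: Bv_L1. Qed.

Let Ev_init p : Ev p t0 = P *m p.2.
Proof. exact: (duhamel_init t0_le_T Phi_ac). Qed.

Let Ev_unique p x : L p ->
  ac_deriv t0 T x (fun t => A t *m x t + B t *m p.1 t) -> x t0 = P *m p.2 ->
  forall t, t \in `[t0, T] -> x t = Ev p t.
Proof. by move=> Lp; apply: duhamel_unique => //; exact: Bv_L1. Qed.

(** By uniqueness of solutions, rather than by linearity of the integral. *)
Let Ev_lin c p q t : L p -> L q -> t \in `[t0, T] ->
  Ev (c *: p + q) t = c *: Ev p t + Ev q t.
Proof.
move=> Lp Lq tI; apply/esym.
apply: (Ev_unique (x := fun t => c *: Ev p t + Ev q t)) => //.
- exact: (sh_lin N_hilbert).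
- apply: (ac_ext t0_le_T _ _ (ac_add (ac_scale c t0_le_T (Ev_ac Lp)) (Ev_ac Lq))) => // s _ /=.
  by rewrite !mulmxDr -!scalemxAr scalerDr addrACA.
- by rewrite !Ev_init /= mulmxDr -scalemxAr.
Qed.

(** The transpose of Duhamel's formula applied to z: in the control component
    B^T(s) Phi^T(t, s) z before t and 0 after, in the initial component the
    preimage under M of P Phi^T(t, t0) z. *)
Let section_of t (z : 'rV[R]_n) : (R -> 'cV[R]_d) * 'cV[R]_n :=
  (fun s => \1_`[t0, t] s *:
     ((B s)^T *m (invmx (Phi s t0))^T *m (Phi t t0)^T *m z^T),
   invmx M *m P *m (Phi t t0)^T *m z^T).

Let Y_mbdd : mxall (mbdd t0 T) (fun s => invmx (Phi s t0)).
Proof. exact: (transition_inv_mbdd t0_le_T A_L1). Qed.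

Let section_base_L2 t (z : 'rV[R]_n) :
  Lmx 2%:E t0 T (fun s => (B s)^T *m (invmx (Phi s t0))^T *m (Phi t t0)^T *m z^T).
Proof.
apply: Lmx2_mulr; last exact: mbdd_mxcst.
apply: Lmx2_mulr; last exact: mbdd_mxcst.
by apply: Lmx2_mulr; [exact: Lmx2_tr B_L2|exact: mxall_tr Y_mbdd].
Qed.

Let section_L t z : L (section_of t z).
Proof. by apply: Lmx2_mask; [exact: itv_meas|exact: section_base_L2]. Qed.

Let section_repr t z p : t \in `[t0, T] -> L p ->
  (z *m Ev p t) 0 0 = N p (section_of t z).
Proof.
move=> tI Lp; have hq := Bv_L1 Lp.
rewrite /Ev /duhamel /N /control_ip mulmxA mulmxDr [LHS]mxE; congr (_ + _).
  rewrite dotp_mull M_sym /= !mulmxA mulmxV// mul1mx dotpC dotpE.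
  by rewrite !trmx_mul !trmxK (proj1 P_psd) !mulmxA.
rewrite (mxint_mull _ t0_le_T tI (Lmx1_mull Y_mbdd hq)) mxE.
have tE : Num.min T t = t by apply: min_r; move: tI; rewrite in_itv => /andP[].
have := itg_cut t0 T t
  (fun s => (z *m Phi t t0 *m (invmx (Phi s t0) *m (B s *m p.1 s))) 0 0).
rewrite tE => <-; apply: itg_ext => // s _; rewrite /= dotpZr; congr (_ * _).
by rewrite dotpC dotpE !trmx_mul !trmxK !mulmxA.
Qed.

(** The cut-off at t turns the integral up to s into one up to min(s, t), and
    B B^T = G Q G^T off Z. *)
Let section_kernel s t z : s \in `[t0, T] -> t \in `[t0, T] ->
  Ev (section_of t z) s = trajectory_kernel t0 G Q Pi0 Sigma Phi s t *m z^T.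
Proof.
move=> sI tI; have hq := Bv_L1 (section_L t z).
rewrite /Ev /duhamel /trajectory_kernel mulmxDr mulmxDl -/P -/M; congr (_ + _).
  by rewrite /= !mulmxA.
have minI : Num.min s t \in `[t0, T].
  move: sI tI; rewrite !in_itv /= => /andP[s1 s2] /andP[t1 t2].
  by rewrite le_min s1 t1 ge_min s2.
have hK : Lmx 1 t0 T (fun tau => Phi s t0 *m invmx (Phi tau t0) *m
    (G tau *m Q tau *m (G tau)^T) *m (Phi t t0 *m invmx (Phi tau t0))^T).
  apply: Lmx1_mulr; last by apply: mxall_tr; exact: mbdd_mul (@mbdd_mxcst _ _ _ _ _ _) Y_mbdd.
  by apply: Lmx1_mull => //; exact: mbdd_mul (@mbdd_mxcst _ _ _ _ _ _) Y_mbdd.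
have hK' : Lmx 1 t0 T (fun tau =>
    Phi s tau *m G tau *m Q tau *m (G tau)^T *m (Phi t tau)^T).
  apply: Lmx1_ext hK => tau tauI.
  by rewrite !(transitionE t0_le_T A_L1 Phi_ac tauI)// !mulmxA.
rewrite (mxint_mull _ t0_le_T sI (Lmx1_mull Y_mbdd hq)).
rewrite (mxint_mulr _ t0_le_T minI hK') -mxint_cut.
apply/matrixP => i j; rewrite !mxE.
have L1s k (V : R -> 'M[R]_(n, k)) i' j' : Lmx 1 t0 T V -> L1 `[t0, s] (fun x => V x i' j').
  by move=> /Lmx1P hV; exact: (L1_itvl sI).
apply: itg_ae => //.
- exact: L1s (Lmx1_mull (@mbdd_mxcst _ _ _ _ _ _) (Lmx1_mull Y_mbdd hq)).
- have h := L1s _ _ i j (Lmx1_mulr hK' (@mbdd_mxcst _ _ _ _ _ z^T)).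
  apply: (L1_ext (itv_meas t0 s) _ (L1_mbdd (mbdd_indic t0 s (itv_meas t0 t)) h)) => x _.
  by rewrite [RHS]mxE.
- apply: ae_offZ => tau Ztau taus.
  have tauI : tau \in `[t0, T] by exact: (itv_subl sI).
  rewrite [RHS]mxE !(transitionE t0_le_T A_L1 Phi_ac tauI)//=.
  rewrite -!scalemxAr [LHS]mxE; congr (_ * _); congr (fun_of_matrix _ i j).
  transitivity (Phi s t0 *m invmx (Phi tau t0) *m (B tau *m (B tau)^T) *m
      ((invmx (Phi tau t0))^T *m (Phi t t0)^T) *m z^T); first by rewrite !mulmxA.
  by rewrite BBt// trmx_mul !mulmxA.
Qed.


(** The relation [generates] with the masked coefficient B, which is easier to
    handle: all the functions in it are measurable. *)
Let gen (x : R -> 'cV[R]_n) (u : R -> 'cV[R]_d) (xi : 'cV[R]_n) :=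
  [/\ Lmx 2%:E t0 T u, ac_deriv t0 T x (fun t => F t *m x t + B t *m u t) &
      x t0 = P *m xi].

Let feedback x u : R -> 'cV[R]_d := fun t => u t + (B t)^T *m Sigma t *m x t.

Let F_drift_L1 x u (V : R -> 'cV[R]_n) : ac_deriv t0 T x V -> Lmx 2%:E t0 T u ->
  Lmx 1 t0 T (fun t => F t *m x t + B t *m u t).
Proof.
move=> hx hu; apply: Lmx1_add; last exact: Bv_L1.
exact: Lmx1_mulr F_L1 (ac_mbdd t0_le_T hx).
Qed.

Let A_drift_L1 x u (V : R -> 'cV[R]_n) : ac_deriv t0 T x V -> Lmx 2%:E t0 T u ->
  Lmx 1 t0 T (fun t => A t *m x t + B t *m u t).
Proof.
move=> hx hu; apply: Lmx1_add; last exact: Bv_L1.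
exact: Lmx1_mulr A_L1 (ac_mbdd t0_le_T hx).
Qed.

Let feedback_L2 x u (V : R -> 'cV[R]_n) : ac_deriv t0 T x V -> Lmx 2%:E t0 T u ->
  Lmx 2%:E t0 T (feedback x u).
Proof.
move=> hx hu; apply: Lmx2_add => //.
apply: Lmx2_mulr; last exact: ac_mbdd hx.
by apply: Lmx2_mulr; [exact: Lmx2_tr B_L2|].
Qed.

Let feedback_drift x u t : t \in `[t0, T] -> ~ Z t ->
  A t *m x t + B t *m feedback x u t = F t *m x t + B t *m u t.
Proof.
move=> tI Zt; rewrite /A /feedback -(BBt tI Zt) mulmxDr mulmxBl !mulmxA.
by rewrite addrA addrAC subrK.
Qed.

Let generates_gen x u xi : generates t0 T F G Q Pi0 x u xi -> gen x u xi.
Proof.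
move=> [hu hx x0]; split; [exact: hu| |exact: x0].
apply: (ac_ae (F_drift_L1 hx hu) _ hx); apply: ae_offZ => t Zt _.
by rewrite /B /Qm maskN// scale1r.
Qed.

(** On Z the square root of Q may differ from that of the masked weight; a control
    that vanishes there does not see the difference. *)
Let masked (u : R -> 'cV[R]_d) t := mask t *: u t.

Let gen_generates x u xi : gen x u xi -> generates t0 T F G Q Pi0 x (masked u) xi.
Proof.
move=> [hu hx x0]; split; [exact: Lmx2_mask| |exact: x0].
apply: (ac_ext t0_le_T _ _ hx) => // t _; congr (_ + _).
rewrite /masked /B /Qm -scalemxAr; have [Zt|Zt] := pselect (Z t).
  by rewrite maskZ// !scale0r psd_sqrt0 mulmx0 mul0mx.
by rewrite maskN// !scale1r.
Qed.

Let energy_masked u (xi : 'cV[R]_n) : Lmx 2%:E t0 T u ->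
  energy t0 T (masked u) xi = energy t0 T u xi.
Proof.
move=> hu; congr (_ + _); apply: itg_ae => //.
- by apply: L1_dotp; exact: Lmx2_mask.
- exact: L1_dotp.
- by apply: ae_offZ => t Zt _; rewrite /masked maskN// scale1r.
Qed.

Let gen_fiber x u xi : gen x u xi -> fiber L Ev `[t0, T] x (feedback x u, xi).
Proof.
move=> [hu hx x0]; have hv := feedback_L2 hx hu; split=> // t tI.
apply/esym; apply: Ev_unique => //.
apply: (ac_ae (A_drift_L1 hx hv) _ hx); apply: ae_offZ => s Zs sI.
by rewrite feedback_drift.
Qed.

Let unfeedback (x : R -> 'cV[R]_n) v : R -> 'cV[R]_d :=
  fun t => v t - (B t)^T *m Sigma t *m x t.

Let feedbackK x v : feedback x (unfeedback x v) = v.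
Proof. by apply/funext => t; rewrite /feedback /unfeedback subrK. Qed.

Let fiber_gen x v xi : fiber L Ev `[t0, T] x (v, xi) -> gen x (unfeedback x v) xi.
Proof.
move=> [Lv vx].
have hx : ac_deriv t0 T x (fun t => A t *m x t + B t *m v t).
  by apply: (ac_ext t0_le_T _ _ (Ev_ac Lv)) => t tI; rewrite vx.
have hu : Lmx 2%:E t0 T (unfeedback x v).
  apply: Lmx2_add => //; apply: Lmx2_opp.
  apply: Lmx2_mulr; last exact: ac_mbdd hx.
  by apply: Lmx2_mulr; [exact: Lmx2_tr B_L2|].
split=> //; last by rewrite -vx// Ev_init.
apply: (ac_ae (F_drift_L1 hx hu) _ hx); apply: ae_offZ => t Zt tI.
by rewrite -(feedback_drift x (unfeedback x v) tI Zt) feedbackK.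
Qed.

Let state_cost x1 x2 : R := dotp (SigmaT *m x1 T) (x2 T) +
  \int[mu]_(s in `[t0, T]) dotp (C s *m x1 s) (x2 s).

(** Integrate the derivative of <Sigma x1, x2> over [t0, T]; the boundary terms are
    <SigmaT x1(T), x2(T)> and <Sigma(t0) P xi1, P xi2>. *)
Let completion x1 u1 xi1 x2 u2 xi2 : gen x1 u1 xi1 -> gen x2 u2 xi2 ->
  dotp xi1 xi2 + (\int[mu]_(s in `[t0, T]) dotp (u1 s) (u2 s)) + state_cost x1 x2 =
  N (feedback x1 u1, xi1) (feedback x2 u2, xi2).
Proof.
move=> [hu1 hx1 x10] [hu2 hx2 x20].
have [_ hS ST] := Sigma_sol.
have hv1 := feedback_L2 hx1 hu1; have hv2 := feedback_L2 hx2 hu2.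
have I_u : L1 `[t0, T] (fun s => dotp (u1 s) (u2 s)) by exact: L1_dotp.
have I_v : L1 `[t0, T] (fun s => dotp (feedback x1 u1 s) (feedback x2 u2 s)).
  exact: L1_dotp.
have I_C : L1 `[t0, T] (fun s => dotp (C s *m x1 s) (x2 s)).
  have := Lmx1_mulr (Lmx1_tr (Lmx1_mulr C_L1 (ac_mbdd t0_le_T hx1))) (ac_mbdd t0_le_T hx2).
  by move=> /Lmx1P /(_ 0 0); apply: L1_ext => // s _; rewrite dotpE.
have hphi := ac_mul t0_le_T (ac_tr (ac_mul t0_le_T hS hx1)) hx2.
have [/Lmx1P /(_ 0 0) I_phi /(_ T T_in) /matrixP /(_ 0 0)] := hphi.
rewrite [RHS]mxE -!dotpE ST x10 x20 [X in _ + X]mxE => E.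
have : \int[mu]_(s in `[t0, T]) dotp (feedback x1 u1 s) (feedback x2 u2 s) +
    -1 * (\int[mu]_(s in `[t0, T]) dotp (u1 s) (u2 s) +
          \int[mu]_(s in `[t0, T]) dotp (C s *m x1 s) (x2 s)) =
    dotp (SigmaT *m x1 T) (x2 T) - dotp (Sigma t0 *m (P *m xi1)) (P *m xi2).
  rewrite E [RHS]addrAC subrr add0r -itgD// -itgZ//; last exact: L1D.
  rewrite -itgD//; last by apply: L1Z => //; exact: L1D.
  apply: itg_ae => //.
    by apply: L1D => //; apply: L1Z => //; exact: L1D.
  apply: ae_offZ => s Zs sI.
  rewrite [RHS]mxE -!dotpE.
  have := riccati_pointwise (F s) (C s) (B s) (x1 s) (x2 s) (u1 s) (u2 s) (Sigma_sym sI).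
  by rewrite (BBt sI Zs) /C !mulmxA => <-.
rewrite /state_cost /N /control_ip /= /M mulmxDl mul1mx dotpDl.
have -> : dotp (P *m Sigma t0 *m P *m xi1) xi2 = dotp (Sigma t0 *m (P *m xi1)) (P *m xi2).
  by rewrite -!mulmxA dotp_mull (proj1 P_psd).
rewrite -addrA => h.
set a1 := dotp xi1 xi2; set a2 := dotp (Sigma t0 *m _) _ in h *.
move: h; lra.
Qed.

(** The two norms of a generating pair differ by a quantity that depends on the
    trajectory only, so they have the same minimizers. *)
Let energy_cost x u xi : gen x u xi ->
  N (feedback x u, xi) (feedback x u, xi) = energy t0 T u xi + state_cost x x.
Proof. by move=> h; rewrite -(completion h h) /energy (addrC (dotp xi xi)). Qed.

Let S := trajectories (W11 t0 T) t0 T F G Q Pi0.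

Let trajectoryP x : S x <-> fiber L Ev `[t0, T] x !=set0.
Proof.
split=> [[_ [u [xi /generates_gen h]]]|[[v xi] /fiber_gen h]].
  by exists (feedback x u, xi); exact: gen_fiber.
have [hu hx x0] := gen_generates h; split; last by do 2 eexists; split; eassumption.
by eexists; last exact: hx; case: hx.
Qed.

Let repr := representative t0 T F G Q Pi0.

(** The default value of [representative] is never taken: a minimal preimage,
    masked and brought back to the control u, has least energy. *)
Let reprP x : S x -> is_representative t0 T F G Q Pi0 x (repr x).1 (repr x).2.
Proof.
move=> /trajectoryP fx.
have [[v xi] [vf vmin]] := exists_fiber_minimizer N_hilbert Ev_lin
  (fun t z _ => section_L t z) section_repr fx.
apply: (@xgetPex _ _ [set p | is_representative t0 T F G Q Pi0 x p.1 p.2]).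
have g := fiber_gen vf; have [hu _ _] := g.
exists (masked (unfeedback x v), xi); split; first exact: gen_generates.
move=> u' xi' /generates_gen g'.
have := vmin _ (gen_fiber g'); rewrite (energy_cost g').
by rewrite -[v in X in X -> _](feedbackK x v) (energy_cost g) energy_masked// lerD2r.
Qed.

Let lift x : (R -> 'cV[R]_d) * 'cV[R]_n := (feedback x (repr x).1, (repr x).2).

Let lift_min x : S x -> norm_minimizer N (fiber L Ev `[t0, T] x) (lift x).
Proof.
move=> /reprP [/generates_gen g emin]; split; first exact: gen_fiber.
move=> [v xi] vf; have g' := fiber_gen vf; have [hu' _ _] := g'.
rewrite -(feedbackK x v) (energy_cost g) (energy_cost g') lerD2r.
by rewrite -(energy_masked _ hu'); apply: emin; exact: gen_generates.
Qed.

Let ip := trajectory_ip t0 T F G H Q W Pi0 SigmaT.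

Let ip_lift x y : S x -> S y -> ip x y = N (lift x) (lift y).
Proof.
move=> /reprP [/generates_gen gx _] /reprP [/generates_gen gy _].
rewrite -(completion gx gy) /ip /trajectory_ip /state_cost /lift -/repr.
case: (repr x) (repr y) => [u1 xi1] [u2 xi2] /=.
by rewrite -/(C _); ring.
Qed.

Theorem trajectories_rkhs :
  is_rkhs `[t0, T] S ip (trajectory_kernel t0 G Q Pi0 Sigma Phi).
Proof.
exact: (rkhs_of_feature_map N_hilbert Ev_lin (fun t z _ => section_L t z)
  section_repr trajectoryP section_kernel lift_min ip_lift).
Qed.

End ClosedLoop.

Theorem theorem3 (R : realType) (n m d : nat)
    (n_gt0 : (0 < n)%N) (m_gt0 : (0 < m)%N) (d_gt0 : (0 < d)%N)
    (t0 T : R) (t0_lt_T : t0 < T)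
    (F : R -> 'M[R]_n) (G : R -> 'M[R]_(n, d)) (H : R -> 'M[R]_(m, n))
    (Q : R -> 'M[R]_d) (W : R -> 'M[R]_m) (Pi0 SigmaT : 'M[R]_n)
    (F_L1 : Lmx 1 t0 T F)
    (G_L2 : Lmx 2%:E t0 T G)
    (H_L2 : Lmx 2%:E t0 T H)
    (Q_L1 : Lmx 1 t0 T Q)
    (Q_psd : {ae @lebesgue_measure R, forall t, t \in `[t0, T] -> is_psd (Q t)})
    (W_L2 : Lmx 2%:E t0 T W)
    (W_coercive : exists2 r : R, 0 < r &
       {ae @lebesgue_measure R, forall t, t \in `[t0, T] ->
          is_psd (W t - r%:M)})
    (Pi0_psd : is_psd Pi0)
    (SigmaT_psd : is_psd SigmaT)
    (GQG_L1 : Lmx 1 t0 T (fun t => G t *m Q t *m (G t)^T))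
    (Sigma : R -> 'M[R]_n)
    (Sigma_sol : is_riccati_solution t0 T F G H Q W SigmaT Sigma)
    (Phi : R -> R -> 'M[R]_n)
    (Phi_sol : is_transition_matrix t0 T F G Q Sigma Phi) :
  let ip := trajectory_ip t0 T F G H Q W Pi0 SigmaT in
  let K := trajectory_kernel t0 G Q Pi0 Sigma Phi in
  let S_H1 := trajectories (H1 t0 T) t0 T F G Q Pi0 in
  let S_W11 := trajectories (W11 t0 T) t0 T F G Q Pi0 in
  (S_W11 `<=` H1 t0 T -> is_rkhs `[t0, T] S_H1 ip K) /\
  is_rkhs `[t0, T] S_W11 ip K.
Proof.
have [Z [Z_meas Z_null Z_psd]] := Q_psd.
have Q_psd_off t : t \in `[t0, T] -> ~ Z t -> is_psd (Q t).
  by move=> tI Zt; apply: contrapT => nQ; apply: Zt; apply: Z_psd => /(_ tI).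
move=> ip K S_H1 S_W11.
have rkhs_W11 : is_rkhs `[t0, T] S_W11 ip K.
  exact: (trajectories_rkhs (ltW t0_lt_T) F_L1 G_L2 Q_L1 Pi0_psd GQG_L1 Sigma_sol
    Phi_sol Z_meas Z_null Q_psd_off).
split=> // W11_H1; suff -> : S_H1 = S_W11 by [].
apply/seteqP; split=> x [hx [u [xi gx]]]; split; try by exists u, xi.
  have [_ hac _] := gx; eexists; last exact: hac.
  by case: hac.
by apply: W11_H1; split=> //; exists u, xi.
Qed.
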